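(* Let $d\in\mathbb{N}$, $\alpha>1/2$, and let $1\ge\gamma_1\ge\gamma_2\ge\cdots>0$ be product weights. Let $\tau>0$ and $\delta\in(0,1)$ be given. Then there exist choices of a prime number $N$ (with $N_*\ge1$) and an odd positive integer $R$ such that for any $f\in\mathcal{H}_{d,\alpha,\boldsymbol{\gamma}}$, with probability at least $1-\delta$, the output $A^{\mathrm{rand}}(f)$ of the median lattice-based algorithm, which uses $M=RN$ evaluations of $f$, satisfies $$\|f-A^{\mathrm{rand}}(f)\|_{L_2}^2\le C_N(\tau,\delta,\alpha)\,\frac{\|f\|_{d,\alpha,\boldsymbol{\gamma}}^2}{M^{2\alpha}}\,\exp(2\alpha\tau^{-1})\,\big(P_N(\tau,d,\boldsymbol{\gamma})\big)^{2\alpha},$$ where $$C_N(\tau,\delta,\alpha)=\Big(\frac{N}{N-1}\Big)^{2\alpha}\Big(2\log\Big(1+\frac{N-1}{4e}\Big)+2\log(\delta^{-1})+1\Big)^{2\alpha}\Big(2\tau^{-1}+1+\frac{2N}{N-1}\log(N-1)\Big).$$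
   Context: **Korobov space.** For $\boldsymbol{h}\in\mathbb{Z}^d$ put $r_{2\alpha,\boldsymbol{\gamma}}(\boldsymbol{h})=\prod_{j=1}^d\max\{|h_j|^{2\alpha}/\gamma_j,1\}$. The weighted Korobov space $\mathcal{H}_{d,\alpha,\boldsymbol{\gamma}}$ is the Hilbert space of (complex-valued) functions $f$ on $[0,1]^d$, one-periodic in each variable and equal pointwise to their absolutely convergent Fourier series $f(\boldsymbol{x})=\sum_{\boldsymbol{h}\in\mathbb{Z}^d}\widehat f(\boldsymbol{h})\exp(2\pi \mathrm{i}\,\boldsymbol{h}\cdot\boldsymbol{x})$, where $\widehat f(\boldsymbol{h})=\int_{[0,1]^d}f(\boldsymbol{x})\exp(-2\pi \mathrm{i}\,\boldsymbol{h}\cdot\boldsymbol{x})\,d\boldsymbol{x}$, with finite norm $\|f\|_{d,\alpha,\boldsymbol{\gamma}}=\big(\sum_{\boldsymbol{h}\in\mathbb{Z}^d}|\widehat f(\boldsymbol{h})|^2r_{2\alpha,\boldsymbol{\gamma}}(\boldsymbol{h})\big)^{1/2}$. $\|\cdot\|_{L_2}$ is the norm of $L_2([0,1]^d)$. **Parameters.** For $\tau>0$ and prime $N$, $$P_N(\tau,d,\boldsymbol{\gamma})=\prod_{j=1}^d\big(1+2\gamma_j^{1/(2\alpha)}(1+\tau\log N)\big),\qquad N_*=\frac{N-1}{\exp(\tau^{-1})P_N(\tau,d,\boldsymbol{\gamma})}.$$ For real $L\ge1$, $\mathcal{A}_d(L)=\{\boldsymbol{h}\in\mathbb{Z}^d: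 r_{2\alpha,\boldsymbol{\gamma}}(\boldsymbol{h})\le L^{2\alpha}\}$. **Median lattice-based algorithm.** Given $\tau$, a prime $N$ and an odd $R\in\mathbb{N}$, draw independently, for $r=1,\dots,R$, $\boldsymbol{z}_r$ uniformly from $\{1,\dots,N-1\}^d$ and $\boldsymbol{\Delta}_r$ uniformly from $[0,1)^d$. For $\boldsymbol{h}\in\mathcal{A}_d(N_* )$ set $$\widehat f_{N,\boldsymbol{z}_r,\boldsymbol{\Delta}_r}(\boldsymbol{h})=\frac1N\sum_{k=0}^{N-1}f\Big(\Big\{\frac{k\boldsymbol{z}_r}{N}+\boldsymbol{\Delta}_r\Big\}\Big)\exp\Big(-2\pi \mathrm{i}\,\boldsymbol{h}\cdot\Big(\frac{k\boldsymbol{z}_r}{N}+\boldsymbol{\Delta}_r\Big)\Big),$$ where $\{\cdot\}$ is the componentwise fractional part, and let $\widehat f_{\mathrm{med}}(\boldsymbol{h})$ be the median over $r\in\{1,\dots,R\}$ of these numbers, the median of complex numbers being the median of the real parts plus $\mathrm{i}$ times the median of the imaginary parts. The output is $(A^{\mathrm{rand}}(f))(\boldsymbol{x})=\sum_{\boldsymbol{h}\in\mathcal{A}_d(N_* )}\widehat f_{\mathrm{med}}(\boldsymbol{h})\exp(2\pi \mathrm{i}\,\boldsymbol{h}\cdot\boldsymbol{x})$. Probabilities are over the random choice of all $\boldsymbol{z}_r,\boldsymbol{\Delta}_r$. *)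

(* Defs.v *)
From HB Require Import structures.
From mathcomp Require Import all_boot all_order all_algebra.
From mathcomp Require Import finmap complex.
From mathcomp Require Import all_classical all_reals all_analysis.

Set Implicit Arguments.
Unset Strict Implicit.
Unset Printing Implicit Defensive.

Import Order.TTheory GRing.Theory Num.Theory.

Local Open Scope classical_set_scope.
Local Open Scope ring_scope.

Notation cmod := ComplexField.Normc.normc.

Section power_of_a_probability.
Context {disp : measure_display} {T : measurableType disp} {R : realType}.

Definition tuple_cons n (p : T * n.-tuple T) : n.+1.-tuple T :=
  [tuple of p.1 :: p.2].

Lemma measurable_tuple_cons n : measurable_fun [set: T * n.-tuple T] (@tuple_cons n).
Proof. by apply: measurable_cons; [exact: measurable_fst|exact: measurable_snd]. Qed.

HB.instance Definition _ n := isMeasurableFun.Build _ _ _ _ (@tuple_cons n)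
  (@measurable_tuple_cons n).

(* n-fold product measure, i.e. the law of n independent draws from [P] *)
Fixpoint prob_pow (P : probability T R) n : probability (n.-tuple T) R :=
  match n with
  | 0 => dirac [tuple]
  | m.+1 => distribution (P \x prob_pow P m)%E (@tuple_cons m)
  end.

End power_of_a_probability.

Section uniform_laws.
Context (R : realType).

(* Lebesgue measure on [0,1]^d.  As [0,1]^d \ [0,1)^d is a null set, this is
   also the uniform distribution on [0,1)^d. *)
Definition cube_measure d : probability (d.-tuple (measurableTypeR R)) R :=
  prob_pow (uniform_prob (@ltr01 R)) d.

Definition generators N d : set (d.-tuple nat) :=
  [set z | forall j : 'I_d, (1 <= tnth z j < N)%N].

Arguments generators : clear implicits.

Lemma measurable_generators N d : measurable (generators N d).
Proof.
rewrite (_ : generators N d = \bigcap_(j in [set: 'I_d])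
   ((fun z : d.-tuple nat => tnth z j) @^-1` [set k | (1 <= k < N)%N])); last first.
  apply/seteqP; split=> [z gz j _|z gz j]; [exact: gz|exact: (gz j I)].
apply: fin_bigcap_measurable => // j _.
by rewrite -[X in measurable X]setTI; exact: measurable_tnth.
Qed.

(* The second argument of [mnormalize] is a default value, used only if
   {1,...,N-1}^d is empty. *)
Definition generator_law N d : probability (d.-tuple nat) R :=
  mnormalize (mrestr (@counting _ R) (@measurable_generators N d))
    (dirac [tuple of nseq d 0%N]).

Definition sample_law N d :
    probability (d.-tuple nat * d.-tuple (measurableTypeR R))%type R :=
  (generator_law N d \x cube_measure d)%E.

End uniform_laws.

Section fourier.
Context {R : realType} {d : nat}.
Implicit Types (f : d.-tuple R -> R[i]) (h : d.-tuple int) (x : d.-tuple R).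

Definition dotp h x : R := \sum_(j < d) (tnth h j)%:~R * tnth x j.

(* exp(2 pi i t) *)
Definition cexp2pi (t : R) : R[i] :=
  Complex (cos (2 * pi * t)) (sin (2 * pi * t)).

Definition cube_integral f : R[i] :=
  Complex (\int[cube_measure R d]_x complex.Re (f x))
          (\int[cube_measure R d]_x complex.Im (f x)).

Definition fourier_coef f h : R[i] :=
  cube_integral (fun x => f x * cexp2pi (- dotp h x)).

(* [s] is the sum of the family [u]: the net of its finite partial sums,
   indexed by the finite sets of frequencies, converges to [s]. *)
Definition has_csum (u : d.-tuple int -> R[i]) (s : R[i]) : Prop :=
  forall e : R, 0 < e -> exists J0 : {fset d.-tuple int},
    forall J : {fset d.-tuple int}, (J0 `<=` J)%fset ->
      cmod (\sum_(h <- J) u h - s) < e.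

Definition L2norm f : \bar R :=
  Lnorm (cube_measure R d) 2%:E (fun x => (cmod (f x))%:E).

End fourier.

(* The weight gamma_j of the mathematical indexing, j >= 1, is [gamma j.-1]. *)
Section korobov.
Context {R : realType} {d : nat} (alpha : R) (gamma : nat -> R).
Implicit Types (f : d.-tuple R -> R[i]) (h : d.-tuple int).

Definition korobov_r h : R :=
  \prod_(j < d) Num.max (`|(tnth h j)%:~R : R| `^ (2 * alpha) / gamma j) 1.

Definition korobov_sqnorm f : \bar R :=
  \esum_(h in [set: d.-tuple int])
     (cmod (fourier_coef f h) ^+ 2 * korobov_r h)%:E.

Definition korobov_norm f : R := Num.sqrt (fine (korobov_sqnorm f)).

Definition coord_shift (j : 'I_d) (x : d.-tuple R) : d.-tuple R :=
  [tuple tnth x i + (i == j)%:R | i < d].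

(* Functions on [0,1]^d that are one-periodic in each variable are represented
   by their periodic extensions to R^d. *)
Definition korobov_space : set (d.-tuple R -> R[i]) :=
  [set f | [/\ forall j x, f (coord_shift j x) = f x,
      (\esum_(h in [set: d.-tuple int]) (cmod (fourier_coef f h))%:E < +oo)%E,
      forall x, has_csum (fun h => fourier_coef f h * cexp2pi (dotp h x)) (f x)
    & (korobov_sqnorm f < +oo)%E]].

Definition freq_set (L : R) : set (d.-tuple int) :=
  [set h | korobov_r h <= L `^ (2 * alpha)].

End korobov.

Section algorithm.
Context {R : realType}.

Definition P_N (alpha : R) (gamma : nat -> R) (N : nat) (tau : R) (d : nat) : R :=
  \prod_(j < d)
    (1 + 2 * gamma j `^ (1 / (2 * alpha)) * (1 + tau * ln N%:R)).

Definition N_star (alpha : R) (gamma : nat -> R) (N : nat) (tau : R) (d : nat)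
    : R :=
  (N%:R - 1) / (expR tau^-1 * P_N alpha gamma N tau d).

Definition C_N (N : nat) (tau delta alpha : R) : R :=
  (N%:R / (N%:R - 1)) `^ (2 * alpha) *
  (2 * ln (1 + (N%:R - 1) / (4 * expR 1)) + 2 * ln delta^-1 + 1) `^ (2 * alpha) *
  (2 * tau^-1 + 1 + 2 * N%:R / (N%:R - 1) * ln (N%:R - 1)).

(* meaningful for sequences of odd length *)
Definition median (s : seq R) : R := nth 0 (sort <=%R s) (size s)./2.

Definition cmedian (s : seq R[i]) : R[i] :=
  Complex (median [seq complex.Re c | c <- s])
          (median [seq complex.Im c | c <- s]).

Context {d : nat}.
Implicit Types (f : d.-tuple R -> R[i]) (z : d.-tuple nat) (x Delta : d.-tuple R).

Definition frac_part x : d.-tuple R :=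
  [tuple tnth x j - (Num.floor (tnth x j))%:~R | j < d].

Definition lattice_point N z Delta (k : nat) : d.-tuple R :=
  [tuple k%:R * (tnth z j)%:R / N%:R + tnth Delta j | j < d].

Definition lattice_coef f N z Delta (h : d.-tuple int) : R[i] :=
  N%:R^-1 * \sum_(k < N)
    f (frac_part (lattice_point N z Delta k)) *
    cexp2pi (- dotp h (lattice_point N z Delta k)).

(* [w] lists the pairs (z_r, Delta_r). *)
Definition median_coef f N m (w : m.-tuple (d.-tuple nat * d.-tuple R))
    (h : d.-tuple int) : R[i] :=
  cmedian [seq lattice_coef f N p.1 p.2 h | p <- w].

Definition median_algorithm (alpha : R) (gamma : nat -> R) (tau : R) f N m
    (w : m.-tuple (d.-tuple nat * d.-tuple R)) (x : d.-tuple R) : R[i] :=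
  \sum_(h \in freq_set alpha gamma (N_star alpha gamma N tau d))
    median_coef f N w h * cexp2pi (dotp h x).

End algorithm.

(* Main.v *)
(** The prime [N] and the odd number [m = 2k - 1] of repetitions are existentially
quantified, so [N] may be taken as large as needed.  Let [A] be the set of retained
frequencies and [T] the sum of [|f^(l)|^2] over [l] outside [A]; since [r > N_*^(2 alpha)]
there, [T <= ||f||^2 / N_*^(2 alpha)].

One randomly shifted lattice rule returns [f^(h)] plus the sum of [f^(l) e((l - h).Delta)]
over the [l <> h] with [(l - h).z = 0] mod [N], and Parseval in [Delta] gives the second
moment of that error for fixed [z].  If [l] and [h] are incongruent mod [N], they are
aliased with probability at most [1 / (N - 1)]; distinct elements of [A] are incongruent
because [2 N_* < N].  As [A] lies in a hyperbolic cross, [|A|] is at most of order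
[N_* (ln N)^(d-1)], whereas [P_N] is of order [(ln N)^d]; hence [|A| / (N - 1)] is small
for large [N].  So with high probability nothing inside [A] is aliased to [h], and in that
case Markov's inequality bounds the squared error by [lam V_h] up to probability
[1 / lam], where the [V_h] sum to at most [2 T].

If a draw is bad with probability at most [p], the median fails for a given [h] with
probability at most [(4 p)^k], and a union bound over [A] costs a factor [N], which is
affordable for [k] near [(ln N + ln (1 / delta)) / 2].  On the good event Parseval bounds
the squared error by [(1 + 4 lam) T]; as [lam] is a constant, the term [ln (N - 1)] in
[C_N] absorbs it. *)

Require Import Defs.
From HB Require Import structures.
From mathcomp Require Import all_boot all_order all_algebra.
From mathcomp Require Import finmap complex.
From mathcomp Require Import all_classical all_reals all_analysis.
From mathcomp Require Import measurable_realfun.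
From mathcomp Require Import ring lra zify.

Set Implicit Arguments.
Unset Strict Implicit.
Unset Printing Implicit Defensive.

Import Order.TTheory GRing.Theory Num.Theory.
Import numFieldNormedType.Exports.
Local Open Scope classical_set_scope.
Local Open Scope ring_scope.

(** * Fourier analysis on the cube *)

Section trig_cube.
Context {R : realType}.
Local Notation mR := (measurableTypeR R).

Lemma prob_bounded_integrable d (T : measurableType d) (P : probability T R)
    (g : T -> R) (M : R) : measurable_fun setT g -> (forall x, `|g x| <= M) ->
  P.-integrable setT (EFin \o g).
Proof.
move=> mg gM; apply: measurable_bounded_integrable => //.
  by rewrite -ge0_fin_numE ?fin_num_measure.
exists M; split; first exact: num_real.
by move=> r Mr x _; exact: le_trans (gM x) (ltW Mr).
Qed.

Lemma cos_int_period (x : R) (k : int) : cos (x + 2 * pi * k%:~R) = cos x.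
Proof.
have H (y : R) (n : nat) : cos (y + 2 * pi * n%:R) = cos y.
  have -> : 2 * pi * n%:R = (pi *+ 2) *+ n :> R.
    by rewrite [X in X * _]mulr_natl mulr_natr.
  exact: (periodicn (@cosD2pi R) n y).
case: k => n; first exact: H.
by rewrite NegzE mulrNz mulrN -[in RHS](subrK (2 * pi * n.+1%:R) x) H.
Qed.

Lemma sin_int_period (x : R) (k : int) : sin (x + 2 * pi * k%:~R) = sin x.
Proof. by rewrite -!cosBpihalf addrAC cos_int_period. Qed.

Lemma measurable_cos_comp d (T : measurableType d) (g : T -> R) :
  measurable_fun setT g -> measurable_fun setT (fun x => cos (g x)).
Proof.
move=> mg; apply: (measurableT_comp (f := cos)) => //.
by apply: continuous_measurable_fun; exact: continuous_cos.
Qed.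

Lemma measurable_sin_comp d (T : measurableType d) (g : T -> R) :
  measurable_fun setT g -> measurable_fun setT (fun x => sin (g x)).
Proof.
move=> mg; apply: (measurableT_comp (f := sin)) => //.
by apply: continuous_measurable_fun; exact: continuous_sin.
Qed.

Lemma measurable_dotp n (h : n.-tuple int) :
  measurable_fun [set: n.-tuple mR] (fun x => dotp h x).
Proof.
rewrite /dotp.
apply: measurable_sum => j.
apply: measurable_funM => //.
exact: measurable_tnth.
Qed.

Lemma integral01_ftc (f F : R -> R) : (forall x : R, is_derive x 1 F (f x)) ->
  continuous f ->
  (\int[lebesgue_measure]_(x in `[0%R, 1%R]) (f x)%:E = (F 1 - F 0)%:E)%E.
Proof.
move=> dF cf; rewrite (@continuous_FTC2 _ _ F) ?EFinB//.
- exact: continuous_subspaceT.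
- have cF : continuous F.
    move=> x; apply/differentiable_continuous/derivable1_diffP.
    by have [] := dF x.
  split.
  + by move=> x _; have [] := dF x.
  + by apply: cvg_at_right_filter; exact: cF.
  + by apply: cvg_at_left_filter; exact: cF.
- by move=> x _; rewrite derive1E; apply: derive_val.
Qed.

(* Integrating [1 + cos] instead of [cos] keeps the integrand nonnegative, so that
   Tonelli's theorem applies without integrability conditions. *)
Lemma integral_cos_unit (k : int) (phi : R) :
  (\int[uniform_prob (@ltr01 R)]_x (1 + cos (2 * pi * (k%:~R * x) + phi))%:E =
   (1 + (k == 0)%:R * cos phi)%:E)%E.
Proof.
rewrite integral_uniform; last 2 first.
- apply/measurable_EFinP; apply: measurable_funD => //.
  apply: measurable_cos_comp.
  apply: measurable_funD => //; exact: measurable_funM.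
- by move=> x; rewrite lee_fin -lerBlDl sub0r cos_geN1.
rewrite subr0 invr1 mul1e.
have [->|k0] := eqVneq k 0.
  under eq_integral do rewrite mul0r mulr0 add0r.
  rewrite integral_cst//= lebesgue_measure_itv/= lte01.
  by rewrite oppr0 adde0 mule1 mul1r.
(* For [k != 0] the antiderivative is [F]; its sine part takes the same value at 0 and 1 by
   periodicity, leaving [F 1 - F 0 = 1]. *)
pose F x : R := x + sin (2 * pi * (k%:~R * x) + phi) / (2 * pi * k%:~R).
have c0 : 2 * pi * k%:~R != 0 :> R.
  by rewrite !mulf_neq0 ?intr_eq0 ?(gt_eqF (pi_gt0 R)).
have dF (x : R) : is_derive x 1 F (1 + cos (2 * pi * (k%:~R * x) + phi)).
  have d1 : is_derive x 1 (fun x : R => (2 * pi * k%:~R) * x + phi) (2 * pi * k%:~R).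
    have d0 := is_deriveD (@is_deriveZ _ _ _ _ (2 * pi * k%:~R) _ _ _ (is_derive_id x (1
        : R)))
      (is_derive_cst phi x (1 : R)).
    by apply: (is_derive_eq d0); rewrite addr0; exact: mulr1.
  have d2 := is_derive1_comp (is_derive_sin _) d1.
  have d3 := @is_deriveZ _ _ _ _ (2 * pi * k%:~R)^-1 _ _ _ d2.
  have d4 := is_deriveD (is_derive_id x (1 : R)) d3.
  have -> : F = (id \+ (2 * pi * k%:~R)^-1 \*: (sin \o (fun x => (2 * pi * k%:~R) * x +
      phi))).
    by apply/funext => y /=; rewrite /F [_^-1 *: _]mulrC !mulrA.
  apply: is_derive_eq.
  by rewrite [_ *: _]mulrC mulfK // !mulrA.
have cf : continuous (fun x : R => 1 + cos (2 * pi * (k%:~R * x) + phi)).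
  move=> x; apply: cvgD; first exact: cvg_cst.
  apply: continuous_comp; last exact: continuous_cos.
  apply: cvgD; last exact: cvg_cst.
  apply: cvgMr; exact: cvgMr.
rewrite (integral01_ftc dF cf) /F mulr0 mulr0 add0r mulr1 [_ + phi]addrC sin_int_period.
by rewrite add0r mul0r addr0 addrK.
Qed.

Lemma dotp_cons n (a : int) (h : n.-tuple int) (x : R) (t : n.-tuple R) :
  dotp [tuple of a :: h] [tuple of x :: t] = a%:~R * x + dotp h t.
Proof.
rewrite /dotp big_ord_recl !tnth0; congr (_ + _).
by apply: eq_bigr => j _; rewrite !tnthS.
Qed.

(** Induction on the dimension by Tonelli. For a fixed first coordinate [x] the term [a * x] joins
    the phase of the remaining integral, which is why [phi] is arbitrary. *)
Lemma integral_cos_cube n (h : n.-tuple int) (phi : R) :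
  (\int[cube_measure R n]_x (1 + cos (2 * pi * dotp h x + phi))%:E =
   (1 + (h == [tuple of nseq n 0%:Z])%:R * cos phi)%:E)%E.
Proof.
have ge n' (h' : n'.-tuple int) (psi : R) x : (0 <= (1 + cos (2 * pi * dotp h' x +
    psi))%:E)%E.
  by rewrite lee_fin -lerBlDl sub0r cos_geN1.
have mf n' (h' : n'.-tuple int) (psi : R) : measurable_fun [set: n'.-tuple mR]
   (fun x => (1 + cos (2 * pi * dotp h' x + psi))%:E).
  apply/measurable_EFinP; apply: measurable_funD => //.
  apply: measurable_cos_comp; apply: measurable_funD => //.
  by apply: measurable_funM => //; exact: measurable_dotp.
elim: n h phi => [|n IH] h phi.
  rewrite integral_dirac//; last exact: mf.
  rewrite /dirac/= indicT mul1e /dotp big_ord0 mulr0 add0r [h]tuple0.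
  by rewrite (_ : (_ == _) = true) ?mul1r//; apply/eqP/val_inj.
rewrite /cube_measure /= ge0_integral_distribution//; last exact: mf.
case/tupleP: h => a h.
rewrite fubini_tonelli1//=; last first.
  exact: (measurableT_comp (mf _ [tuple of a :: h] phi) (@measurable_tuple_cons _ _ _)).
transitivity (\int[uniform_prob (@ltr01 R)]_x
  (1 + (h == [tuple of nseq n 0%:Z])%:R * cos (2 * pi * (a%:~R * x) + phi))%:E)%E.
  apply: eq_integral => x _; rewrite -(IH h).
  apply: eq_integral => t _ /=.
  by rewrite dotp_cons mulrDr addrCA addrA.
have -> : ([tuple of a :: h] == [tuple of nseq n.+1 0%:Z]) =
   (a == 0) && (h == [tuple of nseq n 0%:Z]).
  by rewrite -!val_eqE/= eqseq_cons.
have [_|_] := eqVneq h.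
  by under eq_integral do rewrite mul1r; rewrite integral_cos_unit andbT.
rewrite andbF mul0r addr0.
under eq_integral do rewrite mul0r addr0.
rewrite integral_cst// mul1e.
exact: probability_setT.
Qed.

End trig_cube.

(** * Complex modulus and the exponentials [cexp2pi] *)

Section complex_modulus.
Context {R : realType}.
Implicit Types z : R[i].

Lemma sqr_cmod z : cmod z ^+ 2 = complex.Re z ^+ 2 + complex.Im z ^+ 2.
Proof. by case: z => a b; rewrite /cmod sqr_sqrtr ?addr_ge0 ?sqr_ge0. Qed.

Lemma cmod_ge0 z : 0 <= cmod z.
Proof. by case: z => a b; exact: sqrtr_ge0. Qed.

Lemma cmod0 : cmod (0 : R[i]) = 0.
Proof. exact: ComplexField.Normc.normc0. Qed.

Lemma cmodD z1 z2 : cmod (z1 + z2) <= cmod z1 + cmod z2.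
Proof. exact: complex.le_normcD. Qed.

Lemma cmod_sum (I : Type) (s : seq I) (P : pred I) (F : I -> R[i]) :
  cmod (\sum_(i <- s | P i) F i) <= \sum_(i <- s | P i) cmod (F i).
Proof.
elim/big_ind2 : _ => //; first by rewrite cmod0.
move=> z1 r1 z2 r2 h1 h2; apply: le_trans (cmodD _ _) _; exact: lerD.
Qed.

Lemma ler_Re_cmod z : `|complex.Re z| <= cmod z.
Proof.
rewrite -ler_sqr ?nnegrE ?cmod_ge0// sqr_cmod real_normK ?num_real//.
by rewrite lerDl sqr_ge0.
Qed.

Lemma ler_Im_cmod z : `|complex.Im z| <= cmod z.
Proof.
rewrite -ler_sqr ?nnegrE ?cmod_ge0// sqr_cmod real_normK ?num_real//.
by rewrite lerDr sqr_ge0.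
Qed.

Lemma cReM (z w : R[i]) : complex.Re (z * w) =
  complex.Re z * complex.Re w - complex.Im z * complex.Im w.
Proof. by case: z w => a b []. Qed.

Lemma cImM (z w : R[i]) : complex.Im (z * w) =
  complex.Re z * complex.Im w + complex.Im z * complex.Re w.
Proof. by case: z w => a b []. Qed.

Lemma cexp2piD (s t : R) : cexp2pi (s + t) = cexp2pi s * cexp2pi t.
Proof.
rewrite /cexp2pi mulrDr cosD sinD; congr Complex.
by rewrite addrC mulrC.
Qed.

Lemma cexp2pi_int (k : int) : cexp2pi (k%:~R : R) = 1.
Proof.
rewrite /cexp2pi -[2 * _ * _]add0r cos_int_period sin_int_period.
by rewrite cos0 sin0.
Qed.

Lemma cmod_cexp2pi (t : R) : cmod (cexp2pi t) = 1.
Proof. by rewrite /cmod/= cos2Dsin2 sqrtr1. Qed.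

(** Expanding into a double sum leaves only cosines and sines of phase differences, whose integrals
    over the cube are the orthogonality relations. *)
Lemma sqr_cmod_sum (I : Type) (J : seq I) (c : I -> R[i]) (t : I -> R) :
  cmod (\sum_(h <- J) c h * cexp2pi (t h)) ^+ 2 =
  \sum_(h <- J) \sum_(h' <- J)
    (complex.Re (c h * (c h')^*%C) * cos (2 * pi * (t h - t h')) -
     complex.Im (c h * (c h')^*%C) * sin (2 * pi * (t h - t h'))).
Proof.
rewrite sqr_cmod !raddf_sum/= !expr2 !big_distrlr/= -big_split/=.
apply: eq_bigr => h _; rewrite -big_split/=; apply: eq_bigr => h' _.
rewrite mulrBr cosB sinB; case: (c h) (c h') => [a b] [a' b'] /=.
ring.
Qed.

End complex_modulus.

(** * Series over all frequencies and Parseval's identity *)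

Section csum.
Context {R : realType} {d : nat}.
Local Notation mR := (measurableTypeR R).
Local Notation I := (d.-tuple int).
Implicit Types (h : I) (c : I -> R[i]).

(* An increasing exhaustion of the frequencies: it turns sums over all of them into
   limits of sequences. *)
Definition enumf n : {fset I} := [fset x in pmap (@choice.pickle_inv _) (iota 0 n)]%fset.

Lemma mem_enumf n h : (h \in enumf n) = (choice.pickle h < n)%N.
Proof.
rewrite /enumf !inE/= mem_pmap; apply/mapP/idP => [[k]|hn].
  rewrite mem_iota/= add0n => kn hk.
  have hK : oapp choice.pickle k (Some h) = k by rewrite hk; exact: choice.pickle_invK.
  by move: hK => /= ->.
exists (choice.pickle h); first by rewrite mem_iota.
by rewrite choice.pickleK_inv.
Qed.

Lemma enumf_sub m n : (m <= n)%N -> (enumf m `<=` enumf n)%fset.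
Proof. by move=> mn; apply/fsubsetP => h; rewrite !mem_enumf => /leq_trans; exact. Qed.

Lemma enumf_exhaust (J : {fset I}) : exists n, (J `<=` enumf n)%fset.
Proof.
exists (\max_(h <- J) choice.pickle h).+1; apply/fsubsetP => h hJ.
by rewrite mem_enumf ltnS; exact: leq_bigmax_seq.
Qed.

Lemma sume_le_esum (a : I -> \bar R) (J : {fset I}) : (forall h, 0 <= a h)%E ->
  (\sum_(h <- J) a h <= \esum_(h in [set: I]) a h)%E.
Proof.
move=> a0; apply: esum_ge; exists [set` J]; first by split.
by rewrite fsbig_seq.
Qed.

(** Every finite set of frequencies lies in some [enumf n], so the supremum defining the sum is
    reached along the exhaustion. *)
Lemma esum_enumf_cvg (a : I -> \bar R) : (forall h, 0 <= a h)%E ->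
  (\sum_(h <- enumf n) a h @[n --> \oo] --> \esum_(h in [set: I]) a h)%E.
Proof.
move=> a0; pose S n := (\sum_(h <- enumf n) a h)%E.
have ndS : nondecreasing_seq S.
  move=> m n mn; apply: lee_sum_nneg_subfset => //.
  by apply/fsubsetP/enumf_sub.
have -> : (\esum_(h in [set: I]) a h = ereal_sup (range S))%E.
  apply/eqP; rewrite eq_le; apply/andP; split.
    apply: ge_ereal_sup => _ [X [finX _] <-].
    have [n Xn] := enumf_exhaust (fset_set X).
    apply: (@le_trans _ _ (S n)); last by apply: ereal_sup_ubound; exists n.
    rewrite fsbig_finite//; apply: lee_sum_nneg_subfset => //.
    exact/fsubsetP.
  apply: ge_ereal_sup => _ [n _ <-]; exact: sume_le_esum.
exact: ereal_nondecreasing_cvgn.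
Qed.

Lemma has_csum_enumf (u : I -> R[i]) (s : R[i]) : has_csum u s ->
  forall e : R, 0 < e -> exists n0, forall n, (n0 <= n)%N ->
    cmod (\sum_(h <- enumf n) u h - s) < e.
Proof.
move=> us e e0; have [J0 HJ] := us e e0; have [n0 Jn] := enumf_exhaust J0.
exists n0 => n n0n; apply: HJ; exact: fsubset_trans Jn (enumf_sub n0n).
Qed.

Lemma cvg_Re_enumf (u : I -> R[i]) (s : R[i]) : has_csum u s ->
  complex.Re (\sum_(h <- enumf n) u h) @[n --> \oo] --> complex.Re s.
Proof.
move=> /has_csum_enumf us; apply/cvgrPdist_lt => e e0.
have [n0 Hn] := us e e0; exists n0 => // n /= n0n.
apply: le_lt_trans (Hn n n0n); rewrite distrC -raddfB; exact: ler_Re_cmod.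
Qed.

Lemma cvg_Im_enumf (u : I -> R[i]) (s : R[i]) : has_csum u s ->
  complex.Im (\sum_(h <- enumf n) u h) @[n --> \oo] --> complex.Im s.
Proof.
move=> /has_csum_enumf us; apply/cvgrPdist_lt => e e0.
have [n0 Hn] := us e e0; exists n0 => // n /= n0n.
apply: le_lt_trans (Hn n n0n); rewrite distrC -raddfB; exact: ler_Im_cmod.
Qed.

Definition freqB h h' : I := [tuple tnth h i - tnth h' i | i < d].

Lemma freqB_eq0 h h' : (freqB h h' == [tuple of nseq d 0%:Z]) = (h == h').
Proof.
apply/eqP/eqP => [e|->]; apply: eq_from_tnth => i; last first.
  by rewrite tnth_mktuple subrr tnth_nseq.
move: (congr1 (fun t => tnth t i) e).
by rewrite tnth_mktuple tnth_nseq => /eqP; rewrite subr_eq0 => /eqP.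
Qed.

Lemma dotpB h h' (x : d.-tuple R) : dotp h x - dotp h' x = dotp (freqB h h') x.
Proof.
rewrite /dotp -sumrB; apply: eq_bigr => j _.
by rewrite tnth_mktuple rmorphB mulrBl.
Qed.

Lemma integrable_cos_dotp h (phi : R) : (cube_measure R d).-integrable setT
  (EFin \o (fun x => cos (2 * pi * dotp h x + phi))).
Proof.
apply: (@prob_bounded_integrable _ _ _ _ _ 1) => [|x]; last exact: cos_max.
apply: measurable_cos_comp; apply: measurable_funD => //.
by apply: measurable_funM => //; exact: measurable_dotp.
Qed.

(** The cosine is bounded, so its integral is finite and the constant 1 can be cancelled from
    [integral_cos_cube]. *)
Lemma integral_cos_dotp h (phi : R) :
  (\int[cube_measure R d]_x (cos (2 * pi * dotp h x + phi))%:E =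
   ((h == [tuple of nseq d 0%:Z])%:R * cos phi)%:E)%E.
Proof.
have := integral_cos_cube h phi.
have ic := integrable_cos_dotp h phi.
under eq_integral do rewrite EFinD.
rewrite integralD//=; last first.
  by apply: (@prob_bounded_integrable _ _ _ _ (cst 1) 1) => // x; rewrite normr1.
have : (\int[cube_measure R d]_x (cos (2 * pi * dotp h x + phi))%:E \is a fin_num)%E.
  exact: integrable_fin_num.
case: (integral _ _ _) => // r _.
rewrite integral_cst// mul1e [X in (X + _)%E](_ : _ = 1%E); last exact: probability_setT.
by rewrite -EFinD => -[] /addrI ->.
Qed.

Lemma integral_cos_freqB h h' :
  (\int[cube_measure R d]_x (cos (2 * pi * (dotp h x - dotp h' x)))%:E = (h == h')%:R%:E)%E.
Proof.
under eq_integral do rewrite dotpB -[X in cos X]addr0.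
by rewrite integral_cos_dotp freqB_eq0 cos0 mulr1.
Qed.

(** A sine is a cosine with phase [- pi / 2], and the cosine of that phase is 0 even when
    [h = h']. *)
Lemma integral_sin_freqB h h' :
  (\int[cube_measure R d]_x (sin (2 * pi * (dotp h x - dotp h' x)))%:E = 0)%E.
Proof.
under eq_integral do rewrite dotpB -cosBpihalf.
by rewrite integral_cos_dotp cosN cos_pihalf mulr0.
Qed.

Lemma parseval_fin c (J : {fset I}) :
  (\int[cube_measure R d]_x (cmod (\sum_(h <- J) c h * cexp2pi (dotp h x)) ^+ 2)%:E =
   (\sum_(h <- J) cmod (c h) ^+ 2)%:E)%E.
Proof.
pose g h h' (x : d.-tuple mR) :=
  complex.Re (c h * (c h')^*%C) * cos (2 * pi * (dotp h x - dotp h' x)) -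
     complex.Im (c h * (c h')^*%C) * sin (2 * pi * (dotp h x - dotp h' x)).
have icos h h' : (cube_measure R d).-integrable setT
    (EFin \o (fun x => cos (2 * pi * (dotp h x - dotp h' x)))).
  under eq_fun do rewrite /= dotpB -[X in cos X]addr0.
  exact: integrable_cos_dotp.
have isin h h' : (cube_measure R d).-integrable setT
    (EFin \o (fun x => sin (2 * pi * (dotp h x - dotp h' x)))).
  under eq_fun do rewrite /= dotpB -cosBpihalf.
  exact: integrable_cos_dotp.
have ig h h' : (cube_measure R d).-integrable setT (EFin \o g h h').
  exact: (integrableB measurableT
    (integrableZl measurableT (complex.Re (c h * (c h')^*%C)) (icos h h'))
    (integrableZl measurableT (complex.Im (c h * (c h')^*%C)) (isin h h'))).
(* Only the diagonal survives integration, and there the coefficient of the cosine is [c h] times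
   its conjugate. *)
have Eg h h' : (\int[cube_measure R d]_x (g h h' x)%:E = ((h == h')%:R * cmod (c h) ^+
    2)%:E)%E.
  rewrite /g.
  under eq_integral do rewrite EFinB !EFinM.
  apply: eq_trans.
    exact: (integralB measurableT
      (integrableZl measurableT (complex.Re (c h * (c h')^*%C)) (icos h h'))
      (integrableZl measurableT (complex.Im (c h * (c h')^*%C)) (isin h h'))).
  rewrite (integralZl measurableT (icos h h')) (integralZl measurableT (isin h h')) /=.
  rewrite integral_cos_freqB integral_sin_freqB mule0 sube0 -EFinM; congr EFin.
  have [<-|_] := eqVneq; last by rewrite mulr0 mul0r.
  rewrite mulr1 mul1r sqr_cmod; case: (c h) => a b /=.
  by rewrite mulrN opprK !expr2.
under eq_integral => x _.
  rewrite sqr_cmod_sum -sumEFin; under eq_bigr do rewrite -sumEFin.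
  over.
rewrite integral_sum//=; last first.
  by move=> h; apply: integrable_sum => // h' _; exact: ig.
rewrite -sumEFin; apply: eq_big_seq => h hJ.
rewrite integral_sum//=; last by move=> h'; exact: ig.
under eq_bigr do rewrite Eg.
rewrite (big_fsetD1 h)//= eqxx mul1r big1_fset ?adde0// => h'.
by rewrite !inE eq_sym => /andP[/negbTE -> _]; rewrite mul0r.
Qed.

Lemma esum_cmod_fin c : (\esum_(h in [set: I]) (cmod (c h))%:E < +oo)%E ->
  exists S : R, forall J : {fset I}, \sum_(h <- J) cmod (c h) <= S.
Proof.
move=> cfin.
have c0 h : (0 <= (cmod (c h))%:E)%E by rewrite lee_fin cmod_ge0.
exists (fine (\esum_(h in [set: I]) (cmod (c h))%:E)%E) => J.
rewrite -lee_fin fineK; last first.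
  by rewrite ge0_fin_numE//; exact: esum_ge0.
by rewrite -sumEFin; exact: sume_le_esum.
Qed.

Section fourier_series.
Variables (c : I -> R[i]) (u : d.-tuple R -> R[i]).
Hypothesis cfin : (\esum_(h in [set: I]) (cmod (c h))%:E < +oo)%E.
Hypothesis cu : forall x, has_csum (fun h => c h * cexp2pi (dotp h x)) (u x).

Let un n (x : d.-tuple mR) := \sum_(h <- enumf n) c h * cexp2pi (dotp h x).

Let mcos h : measurable_fun setT (fun x : d.-tuple mR => cos (2 * pi * dotp h x)).
Proof. by apply: measurable_cos_comp; apply: measurable_funM => //; exact:
    measurable_dotp. Qed.

Let msin h : measurable_fun setT (fun x : d.-tuple mR => sin (2 * pi * dotp h x)).
Proof. by apply: measurable_sin_comp; apply: measurable_funM => //; exact: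
    measurable_dotp. Qed.

Let mRe_un n : measurable_fun setT (fun x => complex.Re (un n x)).
Proof.
rewrite /un; under eq_fun do rewrite raddf_sum.
apply: measurable_sum => h.
rewrite [X in measurable_fun _ X](_ : _ = fun x : d.-tuple mR =>
  complex.Re (c h) * cos (2 * pi * dotp h x) - complex.Im (c h) * sin (2 * pi * dotp h x)).
  by apply: measurable_funB; exact: measurable_funM.
by apply/funext => x; rewrite /= cReM.
Qed.

Let mIm_un n : measurable_fun setT (fun x => complex.Im (un n x)).
Proof.
rewrite /un; under eq_fun do rewrite raddf_sum.
apply: measurable_sum => h.
rewrite [X in measurable_fun _ X](_ : _ = fun x : d.-tuple mR =>
  complex.Re (c h) * sin (2 * pi * dotp h x) + complex.Im (c h) * cos (2 * pi * dotp h x)).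
  by apply: measurable_funD; exact: measurable_funM.
by apply/funext => x; rewrite /= cImM.
Qed.

(** [u] is a pointwise limit of trigonometric polynomials. *)
Lemma fourier_series_measurable_Re : measurable_fun [set: d.-tuple mR] (fun x =>
    complex.Re (u x)).
Proof.
apply: measurable_fun_cvg; first exact: mRe_un.
move=> x _; exact: cvg_Re_enumf (cu x).
Qed.

Lemma fourier_series_measurable_Im : measurable_fun [set: d.-tuple mR] (fun x =>
    complex.Im (u x)).
Proof.
apply: measurable_fun_cvg; first exact: mIm_un.
move=> x _; exact: cvg_Im_enumf (cu x).
Qed.

(** The identity for finite sums passes to the limit along [enumf]. All partial sums are bounded by
    the sum [S] of the [cmod (c h)], and the constant [S ^+ 2] is integrable on a probability space,
    so dominated convergence applies. *)
Lemma parseval : (\int[cube_measure R d]_x (cmod (u x) ^+ 2)%:E =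
  \esum_(h in [set: I]) (cmod (c h) ^+ 2)%:E)%E.
Proof.
have [S HS] := esum_cmod_fin cfin.
have unS n x : cmod (un n x) ^+ 2 <= S ^+ 2.
  rewrite lerXn2r ?nnegrE ?cmod_ge0//.
    by apply: le_trans (HS fset0); rewrite big_seq_fset0.
  apply: le_trans (cmod_sum _ _ _) (le_trans _ (HS (enumf n))).
  by apply: ler_sum => h _; rewrite ComplexField.Normc.normcM cmod_cexp2pi mulr1.
have cvg_sq x : cmod (un n x) ^+ 2 @[n --> \oo] --> cmod (u x) ^+ 2.
  have cRe := cvg_Re_enumf (cu x); have cIm := cvg_Im_enumf (cu x).
  rewrite sqr_cmod !expr2 [X in X @ _ --> _](_ : _ = fun n =>
    complex.Re (un n x) * complex.Re (un n x) + complex.Im (un n x) * complex.Im (un n x)).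
    exact: cvgD (cvgM cRe cRe) (cvgM cIm cIm).
  by apply/funext => n; rewrite sqr_cmod !expr2.
have msq (v : d.-tuple mR -> R[i]) : measurable_fun setT (fun x => complex.Re (v x)) ->
    measurable_fun setT (fun x => complex.Im (v x)) ->
    measurable_fun setT (fun x : d.-tuple mR => (cmod (v x) ^+ 2)%:E).
  move=> mRe mIm; apply/measurable_EFinP.
  rewrite [X in measurable_fun _ X](_ : _ = fun x => complex.Re (v x) ^+ 2 + complex.Im
      (v x) ^+ 2).
    by apply: measurable_funD; apply: measurable_funX.
  by apply/funext => x; rewrite sqr_cmod.
have mun n := msq _ (mRe_un n) (mIm_un n).
have mu := msq _ fourier_series_measurable_Re fourier_series_measurable_Im.
have [|||_ _] := @dominated_convergence _ _ _ (cube_measure R d) setT measurableT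
  (fun n x => (cmod (un n x) ^+ 2)%:E) (fun x => (cmod (u x) ^+ 2)%:E) (cst (S ^+ 2)%:E)
      mun mu.
- by apply: aeW => x _; apply: cvg_EFin; [exact: nearW|exact: cvg_sq].
- by apply: (@prob_bounded_integrable _ _ _ _ (cst (S ^+ 2)) (S ^+ 2)) => // x;
    rewrite ger0_norm ?sqr_ge0.
- by apply: aeW => x n _; rewrite /= ger0_norm ?sqr_ge0// lee_fin.
move=> H; have H2 : (\int[cube_measure R d]_x (cmod (un n x) ^+ 2)%:E)%E @[n --> \oo] -->
    (\esum_(h in [set: I]) (cmod (c h) ^+ 2)%:E)%E.
  rewrite [X in X @ _ --> _](_ : _ = fun n => (\sum_(h <- enumf n) (cmod (c h) ^+ 2)%:E)%E).
    by apply: esum_enumf_cvg => h; rewrite lee_fin sqr_ge0.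
  by apply/funext => n; rewrite /= sumEFin parseval_fin.
exact: (cvg_unique _ H H2).
Qed.

End fourier_series.

End csum.

(** * Aliasing *)

Section roots_of_unity.
Context {R : realType}.

Lemma cexp2piN (t : R) : cexp2pi (- t) * cexp2pi t = 1.
Proof. by rewrite -cexp2piD addNr (cexp2pi_int 0). Qed.

Lemma cexp2piX (t : R) k : cexp2pi (k%:R * t) = cexp2pi t ^+ k.
Proof.
elim: k => [|k IH]; first by rewrite mul0r (cexp2pi_int 0).
by rewrite exprS -IH -cexp2piD -addn1 natrD mulrDl mul1r addrC.
Qed.

(** The real part is 1 minus twice the square of [sin (pi * t)], and this sine is positive for
    [0 < t < 1]. *)
Lemma cexp2pi_neq1 (t : R) : 0 < t < 1 -> cexp2pi t != 1.
Proof.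
move=> /andP[t0 t1]; apply/eqP => /(congr1 (@complex.Re R)) /= /eqP.
have -> : 2 * pi * t = (pi * t) *+ 2 by rewrite -[RHS]mulr_natl mulrA.
rewrite cos_mulr2n cos2sin2 mulrnBl addrAC mulr2n addrK subr_eq addrC -subr_eq subrr eq_sym.
rewrite mulrn_eq0 /= expf_eq0 /= gt_eqF// sin_gt0_pi//.
by rewrite mulr_gt0 ?pi_gt0// gtr_pMr ?pi_gt0.
Qed.

(** A geometric sum of powers of an [N]-th root of unity [w]: all terms are 1 if [N] divides [q],
    and otherwise [(w - 1)] times the sum is [w ^+ N - 1 = 0]. *)
Lemma sum_cexp2pi (N : nat) (q : int) : (0 < N)%N ->
  N%:R^-1 * \sum_(k < N) cexp2pi (k%:R * (q%:~R / N%:R) : R) = ((N%:Z %| q)%Z)%:R.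
Proof.
move=> N0; have N0' : N%:R != 0 :> R by rewrite pnatr_eq0 -lt0n.
have N0c : N%:R != 0 :> R[i] by rewrite pnatr_eq0 -lt0n.
under eq_bigr do rewrite cexp2piX.
have [/dvdzP[p ->]|Nq] := boolP (N%:Z %| q)%Z.
  rewrite rmorphM/= mulfK// cexp2pi_int.
  by under eq_bigr do rewrite expr1n; rewrite sumr_const card_ord mulVf.
set w := cexp2pi _.
have wN : w ^+ N = 1 by rewrite -cexp2piX mulrC divfK// cexp2pi_int.
have w1 : w != 1.
  (* Reducing [q] modulo [N] leaves [w] unchanged and brings its argument strictly between 0 and
     1. *)
  rewrite /w (divz_eq q N) rmorphD rmorphM/= mulrDl mulfK// cexp2piD cexp2pi_int mul1r.
  apply: cexp2pi_neq1.
  have Npos : 0 < N%:R :> R by rewrite ltr0n.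
  rewrite ltr_pdivrMr// mul1r divr_gt0//= ?ltr0z.
    by rewrite (_ : N%:R = N%:Z%:~R)// ltr_int ltz_pmod.
  have q0 : (q %% N)%Z != 0 by apply: contra Nq => /eqP/dvdz_mod0P.
  by rewrite lt0r q0 modz_ge0// -lt0n.
have : (w - 1) * \sum_(i < N) w ^+ i = 0.
  by rewrite -subrX1 wN subrr.
move/eqP; rewrite mulf_eq0 subr_eq0 (negbTE w1) /= => /eqP ->.
by rewrite mulr0.
Qed.

End roots_of_unity.

(** * Arithmetic of unconditional sums *)

Section has_csum_theory.
Context {R : realType} {d : nat}.
Local Notation I := (d.-tuple int).
Implicit Types (u v : I -> R[i]) (s t : R[i]).

Lemma has_csum_fin u (J0 : {fset I}) : (forall h, h \notin J0 -> u h = 0) ->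
  has_csum u (\sum_(h <- J0) u h).
Proof.
move=> u0 e e0; exists J0 => J J0J.
suff -> : \sum_(h <- J) u h = \sum_(h <- J0) u h by rewrite subrr cmod0.
apply/esym/big_fset_incl => // h hJ hJ0; exact: u0.
Qed.

Lemma has_csum_add u v s t : has_csum u s -> has_csum v t ->
  has_csum (fun h => u h + v h) (s + t).
Proof.
move=> us vt e e0; have e20 : 0 < e / 2 by rewrite divr_gt0.
have [J1 H1] := us _ e20; have [J2 H2] := vt _ e20.
exists (J1 `|` J2)%fset => J /fsubUsetP[J1J J2J].
rewrite big_split/= opprD addrACA [ltRHS](splitr e).
exact: le_lt_trans (cmodD _ _) (ltrD (H1 _ J1J) (H2 _ J2J)).
Qed.

Lemma has_csum_mulr u s (a : R[i]) : has_csum u s -> has_csum (fun h => u h * a) (s * a).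
Proof.
move=> us e e0.
have a0 : 0 < cmod a + 1 by rewrite ltr_wpDl ?cmod_ge0.
have [J0 H] := us _ (divr_gt0 e0 a0); exists J0 => J /H {}H.
rewrite -mulr_suml -mulrBl ComplexField.Normc.normcM.
apply: (@le_lt_trans _ _ (cmod (\sum_(h <- J) u h - s) * (cmod a + 1))).
  by rewrite ler_wpM2l ?cmod_ge0// lerDl.
by rewrite -ltr_pdivlMr.
Qed.

Lemma has_csum_sum (K : Type) (r : seq K) (u : K -> I -> R[i]) (s : K -> R[i]) :
  (forall k, has_csum (u k) (s k)) ->
  has_csum (fun h => \sum_(k <- r) u k h) (\sum_(k <- r) s k).
Proof.
move=> us; elim: r => [|k r IH].
  rewrite big_nil => e e0; exists fset0 => J _.
  by under eq_bigr do rewrite big_nil; rewrite big1_eq subrr cmod0.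
rewrite big_cons; under [X in has_csum X]funext do rewrite big_cons.
exact: has_csum_add.
Qed.

Lemma has_csum_unique u s t : has_csum u s -> has_csum u t -> s = t.
Proof.
move=> us ut; apply/eqP; rewrite -subr_eq0; apply/eqP/ComplexField.Normc.eq0_normc.
apply/eqP; rewrite eq_le cmod_ge0 andbT; apply/ler_addgt0Pl => e e0.
rewrite addr0; have e20 : 0 < e / 2 by rewrite divr_gt0.
have [J1 H1] := us _ e20; have [J2 H2] := ut _ e20.
have /H1 {}H1 := fsubsetUl J1 J2; have /H2 {}H2 := fsubsetUr J1 J2.
rewrite -[s](subrK (\sum_(h <- (J1 `|` J2)%fset) u h)) -addrA.
apply: le_trans (cmodD _ _) _; rewrite (splitr e) lerD ?ltW//.
by rewrite -opprB complex.normcN.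
Qed.

Lemma eq_has_csum u v s : u =1 v -> has_csum u s -> has_csum v s.
Proof. by move=> /funext ->. Qed.

End has_csum_theory.

(** * The error of one lattice rule as a Fourier series in the shift *)

Section aliasing.
Context {R : realType} {d : nat} (N : nat) (N0 : (0 < N)%N).
Local Notation I := (d.-tuple int).

Definition aliased (z : d.-tuple nat) (h l : I) : bool :=
  (N%:Z %| \sum_(j < d) (tnth l j - tnth h j) * (tnth z j)%:Z)%Z.

Variables (c : I -> R[i]) (f : d.-tuple R -> R[i]).
Hypothesis cf : forall x, has_csum (fun h => c h * cexp2pi (dotp h x)) (f x).

(** Taking fractional parts changes [dotp h x] by an integer, so no term of the Fourier series
    changes. *)
Lemma fourier_frac_part x : f (frac_part x) = f x.
Proof.
apply: has_csum_unique (cf _) _; apply: eq_has_csum (cf x) => h; congr (_ * _).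
have -> : dotp h x = dotp h (frac_part x) + (\sum_(j < d) tnth h j * Num.floor (tnth x
    j))%:~R.
  rewrite rmorph_sum -big_split/=; apply: eq_bigr => j _.
  by rewrite tnth_mktuple rmorphM/= -mulrDr subrK.
by rewrite cexp2piD cexp2pi_int mulr1.
Qed.

Lemma dotp_lattice_point (h : I) z (Delta : d.-tuple R) k :
  dotp h (lattice_point N z Delta k) =
  k%:R * ((\sum_(j < d) tnth h j * (tnth z j)%:Z)%:~R / N%:R) + dotp h Delta.
Proof.
rewrite rmorph_sum mulr_suml mulr_sumr -big_split/=; apply: eq_bigr => j _.
by rewrite tnth_mktuple intrM -pmulrn; ring.
Qed.

(** The Fourier series of [f] is inserted at each lattice point and summed over [k]; the character
    sum [sum_cexp2pi] keeps exactly the frequencies aliased to [h]. The factor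
    [cexp2pi (dotp h Delta)] removes the phase that the shift puts into [lattice_coef]. *)
Lemma lattice_coef_csum z (h : I) (Delta : d.-tuple R) :
  has_csum (fun l => c l * (aliased z h l)%:R * cexp2pi (dotp l Delta))
    (lattice_coef f N z Delta h * cexp2pi (dotp h Delta)).
Proof.
pose p := lattice_point N z Delta.
have H k : has_csum (fun l => c l * cexp2pi (dotp l (p k)) *
    (cexp2pi (- dotp h (p k)) * (N%:R^-1 * cexp2pi (dotp h Delta))))
    (f (frac_part (p k)) * (cexp2pi (- dotp h (p k)) * (N%:R^-1 * cexp2pi (dotp h Delta)))).
  by rewrite fourier_frac_part; apply: has_csum_mulr; exact: cf.
have := has_csum_sum (index_enum 'I_N) (fun k : 'I_N => H k).
rewrite /lattice_coef.
have -> : \sum_(k < N) f (frac_part (p k)) *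
    (cexp2pi (- dotp h (p k)) * (N%:R^-1 * cexp2pi (dotp h Delta))) =
   N%:R^-1 * (\sum_(k < N) f (frac_part (p k)) * cexp2pi (- dotp h (p k))) * cexp2pi
       (dotp h Delta).
  by rewrite mulr_sumr mulr_suml; apply: eq_bigr => k _; ring.
apply: eq_has_csum => l.
rewrite /aliased -(@sum_cexp2pi R N _ N0) !mulr_sumr mulr_suml; apply: eq_bigr => k _.
have -> : cexp2pi (k%:R * ((\sum_(j < d) (tnth l j - tnth h j) * (tnth z j)%:Z)%:~R /
    N%:R)) =
   cexp2pi (dotp l (p k)) * cexp2pi (- dotp h (p k)) * cexp2pi (dotp h Delta) * cexp2pi
       (- dotp l Delta).
  rewrite -!cexp2piD; congr cexp2pi.
  rewrite !dotp_lattice_point.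
  under eq_bigr do rewrite mulrBl.
  rewrite sumrB rmorphB/=; ring.
rewrite -[in LHS](mulr1 (c l)) -(cexp2piN (dotp l Delta)); ring.
Qed.

Lemma aliased_refl z h : aliased z h h.
Proof.
rewrite /aliased big1 ?dvdz0// => j _; by rewrite subrr mul0r.
Qed.

(* Multiplication by a phase of modulus one turns the error into a Fourier series in
   [Delta], to which Parseval applies. *)
Lemma lattice_error_csum z (h : I) (Delta : d.-tuple R) :
  has_csum (fun l => c l * ((l != h) && aliased z h l)%:R * cexp2pi (dotp l Delta))
    ((lattice_coef f N z Delta h - c h) * cexp2pi (dotp h Delta)).
Proof.
(* Subtracting [c h] is adding a family supported on [h] alone; it cancels the term [l = h], as [h]
   is always aliased to itself. *)
pose u l := if l == h then - c h * cexp2pi (dotp h Delta) else 0.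
have u0 l : l \notin [fset h]%fset -> u l = 0 by rewrite inE /u => /negbTE ->.
rewrite mulrDl.
have := has_csum_add (lattice_coef_csum z h Delta) (has_csum_fin u0).
rewrite big_seq_fset1 {2}/u eqxx.
apply: eq_has_csum => l; rewrite /u.
have [->|_] := eqVneq l h; last by rewrite addr0.
by rewrite aliased_refl mulr1 mulr0 mul0r mulNr subrr.
Qed.

(** The phase does not change the modulus, and the aliased coefficients are dominated by those of
    [f], hence absolutely summable as Parseval requires. *)
Lemma lattice_error_sqnorm z (h : I) : (\esum_(l in [set: I]) (cmod (c l))%:E < +oo)%E ->
  (\int[cube_measure R d]_Delta (cmod (lattice_coef f N z Delta h - c h) ^+ 2)%:E =
   \esum_(l in [set: I]) (cmod (c l) ^+ 2 * ((l != h) && aliased z h l)%:R)%:E)%E.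
Proof.
move=> cfin.
have cE (l : I) (b : bool) : cmod (c l * b%:R) = cmod (c l) * b%:R.
  by case: b; rewrite ?mulr1 ?mulr0 ?cmod0.
pose u (Delta : d.-tuple R) := (lattice_coef f N z Delta h - c h) * cexp2pi (dotp h Delta).
transitivity (\int[cube_measure R d]_Delta (cmod (u Delta) ^+ 2)%:E)%E.
  by apply: eq_integral => x _; rewrite /u ComplexField.Normc.normcM cmod_cexp2pi mulr1.
rewrite (@parseval R d (fun l => c l * ((l != h) && aliased z h l)%:R) u).
- by apply: eq_esum => l _; rewrite cE exprMn -natrX; case: (_ && _).
- apply: le_lt_trans cfin; apply: le_esum => l _; rewrite cE lee_fin.
  by case: (_ && _); rewrite ?mulr1 ?mulr0 ?cmod_ge0.
- by move=> x; exact: lattice_error_csum.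
Qed.

End aliasing.

(** * Measurability of complex-valued functions and of the lattice coefficients *)

Section complex_measurability.
Context {R : realType} dT (T : measurableType dT).
Local Notation mR := (measurableTypeR R).

Definition cmeasurable (F : T -> R[i]) :=
  measurable_fun setT (fun x => complex.Re (F x)) /\ measurable_fun setT (fun x =>
      complex.Im (F x)).

Lemma cmeasurable_cst a : cmeasurable (fun=> a).
Proof. by split. Qed.

Lemma cmeasurableM F G : cmeasurable F -> cmeasurable G -> cmeasurable (fun x => F x * G x).
Proof.
move=> [F1 F2] [G1 G2]; split.
  rewrite [X in measurable_fun _ X](_ : _ = fun x => complex.Re (F x) * complex.Re (G x) -
     complex.Im (F x) * complex.Im (G x)); last by apply/funext => x; rewrite cReM.
  by apply: measurable_funB; exact: measurable_funM.
rewrite [X in measurable_fun _ X](_ : _ = fun x => complex.Re (F x) * complex.Im (G x) +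
     complex.Im (F x) * complex.Re (G x)); last by apply/funext => x; rewrite cImM.
by apply: measurable_funD; exact: measurable_funM.
Qed.

Lemma cmeasurable_sum (K : Type) (r : seq K) (F : K -> T -> R[i]) :
  (forall k, cmeasurable (F k)) -> cmeasurable (fun x => \sum_(k <- r) F k x).
Proof.
move=> mF; split.
  rewrite [X in measurable_fun _ X](_ : _ = fun x => \sum_(k <- r) complex.Re (F k x)).
    by apply: measurable_sum => k; have [] := mF k.
  by apply/funext => x; rewrite raddf_sum.
rewrite [X in measurable_fun _ X](_ : _ = fun x => \sum_(k <- r) complex.Im (F k x)).
  by apply: measurable_sum => k; have [] := mF k.
by apply/funext => x; rewrite raddf_sum.
Qed.

Lemma cmeasurable_cexp2pi (g : T -> R) :
  measurable_fun setT g -> cmeasurable (fun x => cexp2pi (g x)).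
Proof.
move=> mg; split; [apply: measurable_cos_comp|apply: measurable_sin_comp];
  exact: measurable_funM.
Qed.

Lemma cmeasurable_sqr_cmod F : cmeasurable F -> measurable_fun setT (fun x => cmod (F x)
    ^+ 2).
Proof.
move=> [F1 F2].
rewrite [X in measurable_fun _ X](_ : _ = fun x => complex.Re (F x) ^+ 2 + complex.Im (F
    x) ^+ 2).
  by apply: measurable_funD; exact: measurable_funX.
by apply/funext => x; rewrite sqr_cmod.
Qed.

End complex_measurability.

Section lattice_measurability.
Context {R : realType} {d : nat} (N : nat).
Local Notation mR := (measurableTypeR R).
Local Notation I := (d.-tuple int).

Lemma measurable_lattice_point k : measurable_fun [set: d.-tuple nat * d.-tuple mR]
  (fun p => lattice_point N p.1 p.2 k : d.-tuple mR).
Proof.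
apply/measurable_fun_tnthP => j.
rewrite [X in measurable_fun _ X](_ : _ = fun p : d.-tuple nat * d.-tuple mR =>
   k%:R * (tnth p.1 j)%:R / N%:R + tnth p.2 j); last first.
  by apply/funext => p /=; rewrite tnth_mktuple.
apply: measurable_funD.
  apply: measurable_funM => //; apply: measurable_funM => //.
  apply: (measurableT_comp (f := (fun n : nat => n%:R : R))) => //.
  apply: (measurableT_comp (f := (fun t : d.-tuple nat => tnth t j))) => //.
  exact: measurable_tnth.
apply: (measurableT_comp (f := (fun t : d.-tuple mR => tnth t j))) => //.
exact: measurable_tnth.
Qed.

Lemma measurable_lattice_coef (c : I -> R[i]) (f : d.-tuple R -> R[i]) (h : I) :
  (forall x, has_csum (fun h => c h * cexp2pi (dotp h x)) (f x)) ->
  cmeasurable (fun p : d.-tuple nat * d.-tuple mR => lattice_coef f N p.1 p.2 h).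
Proof.
move=> cf; rewrite /lattice_coef.
apply: cmeasurableM; first exact: cmeasurable_cst.
apply: cmeasurable_sum => k.
have -> : (fun p : d.-tuple nat * d.-tuple mR => f (frac_part (lattice_point N p.1 p.2 k)) *
    cexp2pi (- dotp h (lattice_point N p.1 p.2 k))) =
  (fun p => f (lattice_point N p.1 p.2 k) * cexp2pi (- dotp h (lattice_point N p.1 p.2 k))).
  by apply/funext => p; rewrite (fourier_frac_part cf).
apply: cmeasurableM.
  split.
    apply: (measurableT_comp (fourier_series_measurable_Re cf)).
    exact: measurable_lattice_point.
  apply: (measurableT_comp (fourier_series_measurable_Im cf)).
  exact: measurable_lattice_point.
apply: cmeasurable_cexp2pi; apply: measurableT_comp => //.
apply: (measurableT_comp (f := (fun t : d.-tuple mR => dotp h t))).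
  exact: measurable_dotp.
exact: measurable_lattice_point.
Qed.

End lattice_measurability.

Lemma mnormalizeE dT (T : measurableType dT) (R : realType) (mu : {measure set T -> \bar R})
    (P : probability T R) (A : set T) (a r : R) :
  mu setT = r%:E -> r != 0 -> mu A = a%:E -> mnormalize mu P A = (a / r)%:E.
Proof. by move=> muT r0 muA; rewrite /mnormalize muT eqe (negbTE r0)/= muA -EFinM. Qed.

(** * The uniform law on generators and the probability of aliasing *)

Section generators.
Context {R : realType} {d : nat} (N : nat) (N1 : (1 < N)%N).
Local Notation Z := (d.-tuple nat).

(** Tuples of naturals are countable with measurable points; this settles every measurability
    question in [z]. *)
Lemma measurable_tuple_nat (A : set Z) : measurable A.
Proof.
apply: countable_measurable; last exact: countableP.
move=> t.
rewrite (_ : [set t] = \bigcap_(j in [set: 'I_d]) ((fun z : Z => tnth z j) @^-1` [set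
    tnth t j])).
  apply: fin_bigcap_measurable => // j _.
  by rewrite -[X in measurable X]setTI; exact: measurable_tnth.
apply/seteqP; split => [_ -> //|z ztj].
by apply: eq_from_tnth => j; exact: (ztj j I).
Qed.

Lemma finite_generators : finite_set (@generators N d).
Proof.
have : finite_set ((fun t : {ffun 'I_d -> 'I_N} => [tuple (t i : nat) | i < d]) @` setT).
  exact: finite_image.
apply: sub_finite_set => z gz.
have zN i : (tnth z i < N)%N by have /andP[] := gz i.
exists [ffun i => Ordinal (zN i)] => //.
by apply: eq_from_tnth => i; rewrite tnth_mktuple ffunE.
Qed.

Lemma generators_neq0 : @generators N d !=set0.
Proof. by exists [tuple 1%N | _ < d] => j; rewrite tnth_mktuple N1. Qed.

Lemma card_generators_gt0 : (0 < #|` fset_set (@generators N d)|)%N.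
Proof.
rewrite lt0n cardfs_eq0; apply/eqP => e; have [z gz] := generators_neq0.
have : z \in fset_set (@generators N d).
  by rewrite in_fset_set ?inE//; exact: finite_generators.
by rewrite e inE.
Qed.

(** As [1 < N], the set of generators is finite and nonempty, so [mnormalize] does not fall back on
    its default measure. *)
Lemma generator_lawE (A : set Z) : generator_law R N d A =
  ((#|` fset_set (A `&` @generators N d)|)%:R / (#|` fset_set (@generators N d)|)%:R)%:E.
Proof.
have fG := finite_generators.
rewrite /generator_law.
have cE (B : set Z) : mrestr (@counting _ R : {measure set Z -> \bar R})
    (@measurable_generators N d) B =
    ((#|` fset_set (B `&` @generators N d)|)%:R)%:E.
  transitivity (@counting _ R (B `&` @generators N d)) => //.
  rewrite /counting asboolT//.
  by apply: sub_finite_set fG => z [].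
apply: mnormalizeE; [|by rewrite pnatr_eq0 -lt0n; exact: card_generators_gt0|exact: cE].
by rewrite -[X in fset_set X]setTI; exact: cE.
Qed.

Definition set_coord (j : 'I_d) (z : Z) (k : nat) : Z :=
  [tuple if i == j then k else tnth z i | i < d].

(* [(z, k) |-> set_coord j z k] is injective on [E x {1, ..., N - 1}]. *)
Lemma generator_law_le (j : 'I_d) (E : set Z) :
  (forall z z', @generators N d z -> @generators N d z' -> E z -> E z' ->
     (forall i, i != j -> tnth z i = tnth z' i) -> tnth z j = tnth z' j) ->
  (generator_law R N d E <= ((N%:R - 1)^-1)%:E)%E.
Proof.
move=> Einj; rewrite generator_lawE lee_fin.
set A := fset_set (E `&` _); set G := fset_set _.
have fG := finite_generators.
have fA : finite_set (E `&` @generators N d) by apply: sub_finite_set fG => z [].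
have N1R : 0 < N%:R - 1 :> R by rewrite subr_gt0 ltr1n.
suff H : (#|` A| * N.-1 <= #|` G|)%N.
  have G0 := card_generators_gt0.
  rewrite ler_pdivrMr ?ltr0n// mulrC ler_pdivlMr//.
  by rewrite (_ : N%:R - 1 = N.-1%:R) -?natrM ?ler_nat// -subn1 natrB// ltnW.
have tn z k i : tnth (set_coord j z k) i = if i == j then k else tnth z i.
  exact: tnth_mktuple.
pose s := [seq set_coord j z k | z <- A, k <- iota 1 N.-1].
have <- : size s = (#|` A| * N.-1)%N by rewrite size_allpairs size_iota.
have memA z : z \in A -> E z /\ generators N z by rewrite in_fset_set// inE.
have memk k : k \in iota 1 N.-1 -> (1 <= k < N)%N.
  by rewrite mem_iota add1n prednK// ltnW.
apply: uniq_leq_size.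
  apply: allpairs_uniq; [exact: fset_uniq|exact: iota_uniq|].
  move=> [z k] [z' k'] /allpairsP[[y l] [/= yA lk [-> ->]]] /allpairsP[[y' l'] [/= y'A
      lk' [-> ->]]].
  move=> /= e.
  have el : l = l' by have := congr1 (fun t => tnth t j) e; rewrite !tn eqxx.
  have ey i : i != j -> tnth y i = tnth y' i.
    by move=> ij; have := congr1 (fun t => tnth t i) e; rewrite !tn (negbTE ij).
  have [Ey Gy] := memA _ yA; have [Ey' Gy'] := memA _ y'A.
  rewrite el; congr pair; apply: eq_from_tnth => i.
  have [->|ij] := eqVneq i j; last exact: ey.
  exact: Einj.
move=> _ /allpairsP[[y l] [/= yA lk ->]].
have [_ Gy] := memA _ yA.
rewrite in_fset_set// inE => i; rewrite tn.
by case: ifP => // _; exact: memk.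
Qed.

(** If two aliasing generators differ at most at [j], then [N] divides the product of
    [tnth l j - tnth h j] and the difference of their entries at [j]. Being prime, [N] divides the
    second factor, which is smaller than [N] in absolute value and so is 0. *)
Lemma aliased_generator_law_le (h l : d.-tuple int) (j : 'I_d) : prime N ->
  ~~ (N%:Z %| tnth l j - tnth h j)%Z ->
  (generator_law R N d [set z | aliased N z h l] <= ((N%:R - 1)^-1)%:E)%E.
Proof.
move=> pN Nlh; apply: (generator_law_le (j := j)) => z z' Gz Gz' /= Ez Ez' eqz.
have : (N%:Z %| (tnth l j - tnth h j) * ((tnth z j)%:Z - (tnth z' j)%:Z))%Z.
  have := rpredB Ez Ez'; rewrite -sumrB (bigD1 j)//= big1 ?addr0 -?mulrBr//.
  by move=> i ij; rewrite eqz// subrr.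
rewrite !dvdzE abszM Euclid_dvdM//= => /orP[H|]; first by case/negP: Nlh; rewrite dvdzE.
have /andP[_ zN] := Gz j; have /andP[_ z'N] := Gz' j.
move=> H; apply/eqP; apply: contraT => zz.
have := dvdn_leq _ H; lia.
Qed.

End generators.

(** * Integrals of sums, union bound and Markov's inequality *)

Section measure_bounds.
Context dT (T : measurableType dT) (R : realType).

(** Monotone convergence along the exhaustion [enumf]. *)
Lemma integral_esum d (mu : {measure set T -> \bar R}) (g : d.-tuple int -> T -> \bar R) :
  (forall l, measurable_fun setT (g l)) -> (forall l x, 0 <= g l x)%E ->
  (\int[mu]_x (\esum_(l in [set: d.-tuple int]) g l x) =
   \esum_(l in [set: d.-tuple int]) \int[mu]_x (g l x))%E.
Proof.
move=> mg g0.
have S0 n x : (0 <= \sum_(l <- enumf n) g l x)%E by exact: sume_ge0.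
have mS n : measurable_fun setT (fun x => \sum_(l <- enumf n) g l x)%E.
  exact: emeasurable_sum.
have H1 := @cvg_monotone_convergence _ _ _ mu setT measurableT
  (fun n x => \sum_(l <- enumf n) g l x)%E mS (fun n x _ => S0 n x).
have ndS x : setT x -> nondecreasing_seq (fun n => \sum_(l <- enumf n) g l x)%E.
  move=> _ m n mn; apply: lee_sum_nneg_subfset => //.
  exact/fsubsetP/enumf_sub.
have {}H1 := H1 ndS.
have H2 : (\int[mu]_x (\sum_(l <- enumf n) g l x))%E @[n --> \oo] -->
    (\esum_(l in [set: d.-tuple int]) \int[mu]_x (g l x))%E.
  rewrite [X in X @ _ --> _](_ : _ = fun n => \sum_(l <- enumf n) \int[mu]_x (g l x))%E.
    by apply: esum_enumf_cvg => l; exact: integral_ge0.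
  by apply/funext => n; rewrite ge0_integral_sum.
rewrite -(cvg_unique _ H1 H2)//; apply: eq_integral => x _.
apply/esym/cvg_lim => //; exact: esum_enumf_cvg.
Qed.

Lemma measure_mem_seq_le (mu : {measure set T -> \bar R}) (I : eqType) (s : seq I) (F : I
    -> set T) :
  (forall i, measurable (F i)) ->
  measurable [set x | exists2 i, i \in s & F i x] /\
  (mu [set x | exists2 i, i \in s & F i x] <= \sum_(i <- s) mu (F i))%E.
Proof.
move=> mF; elim: s => [|a s [mS IH]].
  rewrite (_ : [set x | _] = set0).
    by rewrite big_nil measure0.
  by apply/seteqP; split => // x; case=> i.
rewrite (_ : [set x | _] = F a `|` [set x | exists2 i, i \in s & F i x]); last first.
  apply/seteqP; split => x /=.
    by case=> i; rewrite inE => /predU1P[->|ins] Fi; [left|right; exists i].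
  move=> [Fa|[i ins Fi]]; first by exists a; rewrite ?mem_head.
  by exists i => //; rewrite inE ins orbT.
split; first exact: measurableU.
apply: (@le_trans _ _ (mu (F a) + mu [set x | exists2 i, i \in s & F i x])%E).
  exact: measureU2.
by rewrite big_cons; exact: leeD2l.
Qed.

(** The strict threshold makes the bound hold for [V = 0] too: then [Y] vanishes almost everywhere
    and the event is null. For [V > 0] this is the usual inequality. *)
Lemma markov_le (mu : {measure set T -> \bar R}) (Y : T -> R) (V lam : R) :
  measurable_fun setT Y -> (forall x, 0 <= Y x) -> 0 <= V -> 0 < lam ->
  (\int[mu]_x (Y x)%:E <= V%:E)%E ->
  (mu [set x | (lam * V < Y x)%R] <= (lam^-1)%:E)%E.
Proof.
move=> mY Y0 V0 lam0 IV.
have mEY : measurable_fun setT (EFin \o Y) by exact/measurable_EFinP.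
have aY : (\int[mu]_x `|(EFin \o Y) x| = \int[mu]_x (Y x)%:E)%E.
  by apply: eq_integral => x _; rewrite gee0_abs ?lee_fin.
have mlt : measurable [set x | lam * V < Y x].
  rewrite -[X in measurable X]setTI.
  exact: (emeasurable_fun_o_infty measurableT mEY (lam * V)%:E).
have [V00|Vpos] := leP V 0; last first.
  have := @le_integral_abse _ _ _ mu _ measurableT _ (lam * V) mEY (mulr_gt0 lam0 Vpos).
  rewrite aY => H.
  have {}H : ((lam * V)%:E * mu [set x | (lam * V < Y x)%R] <= V%:E)%E.
    apply: le_trans IV; apply: le_trans H.
    rewrite lee_pmul2l ?lte_fin ?mulr_gt0//; apply: le_measure; rewrite ?inE//.
      by apply: emeasurable_fun_c_infty => //; exact: measurableT_comp.
    by move=> x /= lt; split => //; rewrite lee_fin ger0_norm// ltW.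
  rewrite -(@lee_pmul2l _ (lam * V)%:E)//; last by rewrite lte_fin mulr_gt0.
  apply: le_trans H _.
  by rewrite -EFinM mulrAC divff ?mul1r// gt_eqF.
have Veq : V = 0 by apply/eqP; rewrite eq_le V00.
rewrite Veq in IV.
have I0 : (\int[mu]_x `|(EFin \o Y) x| = 0)%E.
  by apply/eqP; rewrite eq_le integral_ge0// andbT aY.
have [B [mB B0 HB]] := (@ae_eq_integral_abs _ _ _ mu _ measurableT _ mEY).1 I0.
apply: (@le_trans _ _ (mu B)); last by rewrite B0 lee_fin invr_ge0 ltW.
apply: le_measure; rewrite ?inE// => x /= lt; apply: HB => /= /(_ Logic.I) [].
by move: lt; rewrite Veq mulr0 => /[swap] ->; rewrite ltxx.
Qed.

End measure_bounds.

(** * Probability that a single draw is bad *)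

Section aliasing_tail.
Context {R : realType} {d : nat} (N : nat) (pN : prime N).
Local Notation mR := (measurableTypeR R).
Local Notation I := (d.-tuple int).
Variables (c : I -> R[i]) (f : d.-tuple R -> R[i]).
Hypothesis cfin : (\esum_(h in [set: I]) (cmod (c h))%:E < +oo)%E.
Hypothesis cf : forall x, has_csum (fun h => c h * cexp2pi (dotp h x)) (f x).

Definition congruent (h l : I) : bool := [forall j, (N%:Z %| tnth l j - tnth h j)%Z].

(* An upper bound for the probability that a random generator aliases [l] to [h]. *)
Definition alias_weight (h l : I) : R := if congruent h l then 1 else (N%:R - 1)^-1.

Let N1 : (1 < N)%N. Proof. exact: prime_gt1. Qed.
Let N0 : (0 < N)%N. Proof. exact: ltnW. Qed.
Let N1R : 0 < N%:R - 1 :> R. Proof. by rewrite subr_gt0 ltr1n. Qed.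

Lemma alias_weight_ge0 h l : 0 <= alias_weight h l.
Proof. by rewrite /alias_weight; case: ifP => // _; rewrite invr_ge0 ltW. Qed.

Lemma generator_law_aliased h l :
  (generator_law R N d [set z | aliased N z h l] <= (alias_weight h l)%:E)%E.
Proof.
rewrite /alias_weight; case: ifPn => [_|].
  by apply: probability_le1; exact: measurable_tuple_nat.
rewrite negb_forall => /existsP[j]; exact: aliased_generator_law_le.
Qed.

Variables (A : {fset I}) (h : I) (V lam : R).
Hypothesis A_incongruent : forall l, l \in A -> l != h -> ~~ congruent h l.
Hypotheses (V0 : 0 <= V) (lam0 : 0 < lam).
Hypothesis V_ge : (\esum_(l in [set: I])
  (if l \in A then 0 else cmod (c l) ^+ 2 * alias_weight h l)%:E <= V%:E)%E.

Definition alias_inside (z : d.-tuple nat) : bool :=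
  has (fun l => (l != h) && aliased N z h l) A.

(* [V] bounds the second moment of the part of the error due to frequencies outside [A]. *)
Definition bad_sample (p : d.-tuple nat * d.-tuple R) : bool :=
  alias_inside p.1 || (lam * V < cmod (lattice_coef f N p.1 p.2 h - c h) ^+ 2).

Lemma measurable_fun_tuple_nat dT (T : measurableType dT) (g : d.-tuple nat -> T) :
  measurable_fun setT g.
Proof. by move=> _ Y _; exact: measurable_tuple_nat. Qed.

Lemma measurable_sqr_error : measurable_fun [set: d.-tuple nat * d.-tuple mR]
  (fun p => cmod (lattice_coef f N p.1 p.2 h - c h) ^+ 2).
Proof.
have [m1 m2] := measurable_lattice_coef N h cf.
apply: cmeasurable_sqr_cmod; split.
  rewrite [X in measurable_fun _ X](_ : _ = fun p : d.-tuple nat * d.-tuple mR =>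
    complex.Re (lattice_coef f N p.1 p.2 h) - complex.Re (c h)).
    exact: measurable_funB.
  by apply/funext => p; rewrite raddfB.
rewrite [X in measurable_fun _ X](_ : _ = fun p : d.-tuple nat * d.-tuple mR =>
  complex.Im (lattice_coef f N p.1 p.2 h) - complex.Im (c h)).
  exact: measurable_funB.
by apply/funext => p; rewrite raddfB.
Qed.

(** The squared error, cut to 0 at generators that alias some element of [A] to [h], so that only
    frequencies outside [A] enter its mean. *)
Let Y (p : d.-tuple nat * d.-tuple mR) : R :=
  (~~ alias_inside p.1)%:R * cmod (lattice_coef f N p.1 p.2 h - c h) ^+ 2.

Let mY : measurable_fun setT Y.
Proof.
apply: measurable_funM; last exact: measurable_sqr_error.
apply: (measurableT_comp (f := fun z : d.-tuple nat => (~~ alias_inside z)%:R : R)) => //.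
exact: measurable_fun_tuple_nat.
Qed.

Let Y0 p : 0 <= Y p.
Proof. by rewrite mulr_ge0 ?sqr_ge0. Qed.

(** By Tonelli, Parseval is applied in the shift for fixed [z]. Where [Y] is not cut, no [l] in [A]
    contributes; for the other [l], averaging over [z] turns the aliasing indicator into a
    probability, at most [alias_weight h l]. *)
Let integral_Y : (\int[sample_law R N d]_p (Y p)%:E <= V%:E)%E.
Proof.
rewrite /sample_law fubini_tonelli1//=; last exact/measurable_EFinP.
apply: le_trans V_ge.
pose g l (z : d.-tuple nat) : \bar R :=
  ((if l \in A then 0 else cmod (c l) ^+ 2) * (aliased N z h l)%:R)%:E.
have g0 l z : (0 <= g l z)%E.
  by rewrite lee_fin mulr_ge0//; case: ifP => // _; exact: sqr_ge0.
have mg l : measurable_fun setT (g l) by exact: measurable_fun_tuple_nat.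
apply: (@le_trans _ _ (\int[generator_law R N d]_z (\esum_(l in [set: I]) g l z))%E).
  apply: ge0_le_integral => //.
  - by move=> z _; apply: integral_ge0 => D _; rewrite lee_fin.
  - exact: measurable_fun_tuple_nat.
  - exact: measurable_fun_tuple_nat.
  - move=> z _; rewrite /fubini_F /Y /=.
    have [Sz|Sz] /= := boolP (alias_inside z).
      under eq_integral do rewrite mul0r.
      by rewrite integral0; exact: esum_ge0.
    under eq_integral do rewrite mul1r.
    rewrite (lattice_error_sqnorm N0 cf)//; apply: le_esum => l _.
    rewrite lee_fin; case: ifPn => lA; last first.
      by rewrite ler_wpM2l ?sqr_ge0//; case: (_ == _).
    rewrite mul0r; move/hasPn: Sz => /(_ l lA) /negbTE ->.
    by rewrite mulr0.
rewrite integral_esum//; apply: le_esum => l _; rewrite /g.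
case: ifP => _.
  by under eq_integral do rewrite mul0r; rewrite integral0.
under eq_integral do rewrite EFinM.
rewrite ge0_integralZl//=; last 2 first.
- exact: measurable_fun_tuple_nat.
- by rewrite lee_fin sqr_ge0.
rewrite [leRHS]EFinM; apply: lee_wpmul2l; first by rewrite lee_fin sqr_ge0.
apply: le_trans (generator_law_aliased h l).
rewrite (eq_integral (fun z => (\1_[set z | aliased N z h l] z)%:E)).
  by rewrite integral_indic ?setIT//; exact: measurable_tuple_nat.
by move=> z _; rewrite indicE; case: (boolP (aliased N z h l)) => az;
  [rewrite mem_set|rewrite memNset//; exact/negP].
Qed.

Lemma bad_sample_le : measurable [set p : d.-tuple nat * d.-tuple mR | bad_sample p] /\
  (sample_law R N d [set p | bad_sample p] <= (#|` A|%:R / (N%:R - 1) + lam^-1)%:E)%E.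
Proof.
pose S : set (d.-tuple nat) := [set z | alias_inside z].
have mE : measurable [set p : d.-tuple nat * d.-tuple mR | lam * V < cmod (lattice_coef f
    N p.1 p.2 h - c h) ^+ 2].
  rewrite -[X in measurable X]setTI.
  exact: (emeasurable_fun_o_infty measurableT ((measurable_EFinP _ _).2
      measurable_sqr_error) (lam * V)%:E).
have mEY : measurable [set p | lam * V < Y p].
  rewrite -[X in measurable X]setTI.
  exact: (emeasurable_fun_o_infty measurableT ((measurable_EFinP _ _).2 mY) (lam * V)%:E).
have mS : measurable (S `*` [set: d.-tuple mR]).
  by apply: measurableX => //; exact: measurable_tuple_nat.
split.
  rewrite (_ : [set p | _] = (S `*` [set: d.-tuple mR]) `|`
     [set p | lam * V < cmod (lattice_coef f N p.1 p.2 h - c h) ^+ 2]).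
    exact: measurableU.
  apply/seteqP; split => p /=; rewrite /bad_sample.
    by move=> /orP[Sp|lt]; [left|right].
  by move=> [[Sp _]|lt]; apply/orP; [left|right].
(* Off the first event [Y] equals the squared error, so putting [Y] in its place does not change the
   union. *)
rewrite (_ : [set p | _] = (S `*` [set: d.-tuple mR]) `|` [set p | lam * V < Y p]); last
    first.
  apply/seteqP; split => p /=; rewrite /bad_sample /Y.
    case: (boolP (alias_inside p.1)) => [Sp _|Sp /= lt]; first by left.
    by right; rewrite mul1r.
  move=> [[Sp _]|]; first by rewrite [alias_inside _]Sp.
  by case: (alias_inside _); rewrite //= mul1r.
apply: (@le_trans _ _ (sample_law R N d (S `*` [set: d.-tuple mR]) + sample_law R N d
    [set p | (lam * V < Y p)%R])%E).
  exact: measureU2.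
rewrite EFinD; apply: leeD; last exact: markov_le.
have -> : (sample_law R N d (S `*` [set: d.-tuple mR]) = generator_law R N d S)%E.
  apply: (eq_trans (product_measure1E _ _ _ _)) => //; first exact: measurable_tuple_nat.
  by rewrite -[RHS]mule1; congr (_ * _)%E; exact: probability_setT.
pose F l : set (d.-tuple nat) := [set z | (l != h) && aliased N z h l].
have [_] := @measure_mem_seq_le _ _ _ (generator_law R N d) _ A F
  (fun l => measurable_tuple_nat _).
rewrite (_ : [set z | _] = S); last first.
  apply/seteqP; split => z /=.
    by case=> l lA Fl; apply/hasP; exists l.
  by move=> /hasP[l lA Fl]; exists l.
move/le_trans; apply.
apply: (@le_trans _ _ (\sum_(l <- A) ((N%:R - 1)^-1)%:E)%E).
  rewrite big_seq [leRHS]big_seq; apply: lee_sum => l lA; rewrite /F.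
  (* The index [l = h] gives the empty event; every other element of [A] is incongruent to [h] and
     costs [1 / (N - 1)]. *)
  have [->|lh] := eqVneq l h.
    rewrite (_ : [set z | _] = set0) ?measure0 ?lee_fin ?invr_ge0 ?ltW//.
    by apply/seteqP; split.
  have := generator_law_aliased h l.
  by rewrite /alias_weight (negbTE (A_incongruent lA lh)).
rewrite sumEFin lee_fin big_const_seq count_predT iter_addr_0.
by rewrite [leRHS]mulr_natl.
Qed.

End aliasing_tail.

(** * Independent draws and medians *)

Section independent_draws.
Context {dT : measure_display} {T : measurableType dT} {R : realType}.
Variables (P : probability T R) (B : T -> bool) (p : R).
Hypothesis mB : measurable [set x | B x].
Hypothesis PB : (P [set x | B x] <= p%:E)%E.
Hypothesis p0 : 0 <= p.

Lemma measurable_count m k : measurable [set w : m.-tuple T | (k <= count B w)%N].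
Proof.
have mI i : measurable_fun setT (fun w : m.-tuple T => (B (tnth w i))%:R : R).
  apply: (measurableT_comp (f := fun x => (B x)%:R : R)); last exact: measurable_tnth.
  rewrite [X in measurable_fun _ X](_ : _ = \1_[set x | B x]); first exact:
      measurable_indic.
  apply/funext => x; rewrite indicE; case: (boolP (B x)) => Bx.
    by rewrite mem_set.
  by rewrite memNset//; exact/negP.
have mS : measurable_fun setT (fun w : m.-tuple T => \sum_(i < m) (B (tnth w i))%:R : R).
  exact: measurable_sum.
rewrite (_ : [set w | _] = setT `&` [set w | ((k%:R : R)%:E <= (\sum_(i < m) (B (tnth w
    i))%:R)%:E)%E]).
  by apply: emeasurable_fun_c_infty => //; exact/measurable_EFinP.
rewrite setTI; apply/seteqP; split => w /=; rewrite lee_fin -natr_sum ler_nat;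
  by rewrite -(big_tuple _ _ w xpredT (fun x => nat_of_bool (B x))) -sum1_count -big_mkcond.
Qed.

(* Conditioning on the first draw reproduces Pascal's rule. *)
Lemma prob_pow_count_le m k : 
  (prob_pow P m [set w : m.-tuple T | (k <= count B w)%N] <= ('C(m, k)%:R * p ^+ k)%:E)%E.
Proof.
elim: m k => [|m IH] [|k].
- by rewrite bin0 expr0 mul1r; apply: probability_le1; exact: measurable_count.
- rewrite (_ : [set w | _] = set0) ?measure0 ?bin0n ?mul0r//.
  by apply/seteqP; split => // w; rewrite (tuple0 w).
- by rewrite bin0 expr0 mul1r; apply: probability_le1; exact: measurable_count.
pose C1 : set (T * m.-tuple T) := [set x | B x] `*` [set w : m.-tuple T | (k <= count B
    w)%N].
pose C2 : set (T * m.-tuple T) := setT `*` [set w : m.-tuple T | (k.+1 <= count B w)%N].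
have mC1 : measurable C1 by apply: measurableX => //; exact: measurable_count.
have mC2 : measurable C2 by apply: measurableX => //; exact: measurable_count.
apply: (@le_trans _ _ ((P \x prob_pow P m) (C1 `|` C2))%E).
  rewrite /= /distribution /pushforward; apply: le_measure; rewrite ?inE//.
  - rewrite -[X in measurable X]setTI; apply: measurable_tuple_cons => //.
    exact: measurable_count.
  - exact: measurableU.
  move=> [x w] /=; case: (boolP (B x)) => Bx; rewrite ?add1n ?add0n ?ltnS => kw.
    by left.
  by right.
apply: le_trans (measureU2 _ mC1 mC2) _.
rewrite binS natrD mulrDl EFinD addeC; apply: leeD.
  rewrite (_ : (_ C1) = (P [set x | B x] * prob_pow P m [set w | (k <= count B w)%N])%E).
    rewrite exprS mulrCA EFinM; apply: lee_pmul; rewrite ?measure_ge0//; exact: (IH k).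
  by apply: product_measure1E => //; exact: measurable_count.
rewrite (_ : (_ C2) = (P setT * prob_pow P m [set w | (k.+1 <= count B w)%N])%E).
  by rewrite probability_setT mul1e; exact: IH.
by apply: product_measure1E => //; exact: measurable_count.
Qed.

End independent_draws.

(** * Medians of real sequences *)

Section median_theory.
Context {R : realType}.
Implicit Types (s : seq R) (y : R).

(** The median is the sorted entry of index [(size s)./2], so it is at most [y] exactly when the
    sorted entries up to that index, one more than [(size s)./2] of them, are. Counts are what the
    tail bound on bad draws and the measurability proof can handle. *)
Lemma median_le s y : s != [::] -> (median s <= y) = ((size s)./2 < count (fun x : R =>
    (x <= y)%R) s)%N.
Proof.
move=> s0; have ks : ((size s)./2 < size s)%N.
  by case: s s0 => // a s _; rewrite /= ltnS uphalf_half; lia.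
rewrite /median; set k := (size s)./2 in ks *.
have cS : count (fun x : R => (x <= y)%R) s = count (fun x : R => (x <= y)%R) (sort <=%R s).
  by apply/esym/permP; rewrite perm_sort.
have ss := @sort_sorted _ ((fun x y : R => x <= y)) (@le_total _ R) s.
have le_nth i j : (i <= j)%N -> (j < size s)%N -> nth 0 (sort <=%R s) i <= nth 0 (sort
    <=%R s) j.
  move=> ij js; apply: (sorted_leq_nth _ _ _ ss) => //; rewrite ?inE ?size_sort//.
  - exact: le_trans.
  - exact: leq_ltn_trans js.
rewrite cS; apply/idP/idP => H.
  rewrite -(cat_take_drop k.+1 (sort _ s)) count_cat.
  apply: leq_trans (leq_addr _ _).
  rewrite -[X in (X <= _)%N](@size_takel k.+1 _ (sort <=%R s)) ?size_sort//.
  apply/eq_leq/esym/eqP; rewrite -all_count.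
  apply/(all_nthP 0) => i; rewrite size_takel ?size_sort// => ik.
  by rewrite nth_take//; apply: le_trans (le_nth _ _ _ ks) H.
rewrite leNgt; apply/negP => lt; move: H; apply/negP; rewrite -leqNgt.
rewrite -(cat_take_drop k (sort _ s)) count_cat.
rewrite [X in (_ + X)%N](_ : _ = 0%N) ?addn0.
  by apply: leq_trans (count_size _ _) _; rewrite size_takel// size_sort ltnW.
apply/eqP; rewrite -leqn0 leqNgt -has_count; apply/hasPn => x.
move/(nthP 0) => [ i ].
rewrite size_drop size_sort nth_drop => ik <-; rewrite -ltNge.
apply: lt_le_trans lt _; apply: le_nth; first exact: leq_addr.
by rewrite -ltn_subRL.
Qed.

(** A strict majority of entries lies within [t] of [a]. A median below [a - t] would produce a
    second strict majority disjoint from it; on the other side, the first majority already lies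
    below [a + t]. *)
Lemma median_dist s (a t : R) : odd (size s) ->
  (count (fun x : R => ~~ (`|x - a| <= t)%R) s <= (size s)./2)%N -> `|median s - a| <= t.
Proof.
move=> os H; have s0 : s != [::] by case: s os {H}.
set n := size s in os H.
have nE : n = (n./2.*2.+1)%N by rewrite -[LHS]odd_double_half os.
have cC : (n./2 < count (fun x : R => (`|x - a| <= t)%R) s)%N.
  have := count_predC (fun x : R => `|x - a| <= t) s; rewrite -/n.
  rewrite (@eq_count _ (predC _) (fun x : R => ~~ (`|x - a| <= t)%R)) //.
  by move: H; lia.
rewrite ler_distl; apply/andP; split.
  rewrite leNgt; apply/negP => lt.
  (* The median is replaced by a variable [y], to bring the comparison into the form of
     [median_le]. *)
  have [y] : exists2 y, median s <= y & y < a - t by exists (median s).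
  rewrite median_le// -/n => c2 y2.
  have := count_predUI (fun x : R => x <= y) (fun x : R => `|x - a| <= t) s.
  rewrite [X in (_ + X)%N = _](_ : _ = 0%N); last first.
    apply/eqP; rewrite -leqn0 leqNgt -has_count; apply/hasPn => x _ /=.
    rewrite negb_and -!ltNge; apply/orP.
    have [xy|] := leP x y; [right|by left].
    rewrite ltr_normr; apply/orP; right.
    by move: (le_lt_trans xy y2); lra.
  have := count_size (predU (fun x : R => x <= y) (fun x : R => `|x - a| <= t)) s;
      rewrite -/n.
  by move: c2 cC; lia.
rewrite median_le// -/n; apply: leq_trans cC _.
by apply: sub_count => x /=; rewrite ler_distl => /andP[].
Qed.

End median_theory.

(** * Choice of the parameters *)

Section hyperbolic_cross.
Implicit Types (n d : nat) (a : int).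

Definition int_ball n : seq int :=
  0 :: [seq k%:Z | k <- iota 1 n] ++ [seq - k%:Z | k <- iota 1 n].

Lemma mem_int_ball n a : (`|a| <= n)%N -> a \in int_ball n.
Proof.
rewrite inE mem_cat; have [//|a0] := eqVneq a 0 => an /=.
have ain : `|a|%N \in iota 1 n by rewrite mem_iota; lia.
apply/orP; have [age0|alt0] := leP 0 a.
  by left; apply/mapP; exists `|a|%N => //; lia.
by right; apply/mapP; exists `|a|%N => //; lia.
Qed.

Definition freq_size a : nat := maxn `|a| 1.

(** With first coordinate [a], the sizes of the other coordinates may have product at most
    [n %/ freq_size a]. Recursion on the dimension gives a matching recursion for the length. *)
Fixpoint hyperbolic_cross d n : seq (d.-tuple int) :=
  match d with
  | 0 => [:: [tuple]]
  | d'.+1 => flatten [seq [seq cons_tuple a h | h <- hyperbolic_cross d' (n %/ freq_size a)]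
                     | a <- int_ball n]
  end.

Lemma freq_size_gt0 a : (0 < freq_size a)%N.
Proof. by rewrite /freq_size; lia. Qed.

Lemma mem_hyperbolic_cross d n (h : d.-tuple int) :
  (\prod_(j < d) freq_size (tnth h j) <= n)%N -> h \in hyperbolic_cross d n.
Proof.
elim: d n h => [|d IH] n h; first by rewrite tuple0 mem_head.
case/tupleP: h => a h; rewrite big_ord_recl tnth0.
under eq_bigr do rewrite tnthS.
rewrite mulnC => Hn; apply/flatten_mapP; exists a.
  apply: mem_int_ball; apply: leq_trans Hn; apply: (@leq_trans (freq_size a)).
    by rewrite /freq_size; lia.
  by rewrite leq_pmull// prodn_gt0// => j; exact: freq_size_gt0.
apply: map_f; apply: IH.
by rewrite leq_divRL ?freq_size_gt0.
Qed.

Lemma size_hyperbolic_crossS d n : size (hyperbolic_cross d.+1 n) =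
  (size (hyperbolic_cross d n) + (\sum_(1 <= k < n.+1) size (hyperbolic_cross d (n %/
      k))).*2)%N.
Proof.
rewrite /= size_cat size_map divn1; congr (_ + _)%N.
rewrite size_flatten /shape -map_comp.
rewrite map_cat sumn_cat -!map_comp -addnn; congr (_ + _)%N;
  rewrite sumnE big_map /index_iota subn1 /=; apply: eq_big_seq => k; rewrite mem_iota /=
      size_map => kn;
  by congr (size (hyperbolic_cross _ (_ %/ _))); rewrite /freq_size; lia.
Qed.

Context {R : realType}.

(** Each new term satisfies [1 / (n + 2) <= ln (n + 2) - ln (n + 1)], by [ln (1 + x) <= x] at
    [x = - 1 / (n + 2)]. *)
Lemma harmonic_le n : (0 < n)%N -> \sum_(1 <= k < n.+1) k%:R^-1 <= 1 + ln n%:R :> R.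
Proof.
case: n => // n _; elim: n => [|n IH]; first by rewrite big_nat1 invr1 ln1 addr0.
rewrite big_nat_recr//=; apply: le_trans (lerD IH (lexx _)) _.
rewrite -addrA lerD2l.
have n1 : 0 < n.+1%:R :> R by rewrite ltr0n.
have n2 : 0 < n.+2%:R :> R by rewrite ltr0n.
have -> : ln n.+1%:R = ln n.+2%:R + ln (1 - n.+2%:R^-1) :> R.
  rewrite -lnM ?posrE//.
    by congr ln; rewrite mulrBr mulr1 divff ?gt_eqF// -[n.+2]addn1 natrD addrK.
  by rewrite subr_gt0 invf_lt1// ltr1n.
rewrite -[leRHS]addr0 -addrA lerD2l -[leRHS](addNr n.+2%:R^-1) lerD2r.
by apply: le_ln1Dx; rewrite ltrN2 invf_lt1// ltr1n.
Qed.

(** Each further dimension sums the bound over [n %/ k], that is, costs a harmonic sum. The fixed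
    upper bound [M] lets one logarithm serve all these quotients. *)
Lemma size_hyperbolic_cross d n M : (0 < n <= M)%N ->
  (size (hyperbolic_cross d.+1 n))%:R <= 3 ^+ d.+1 * n%:R * (1 + ln M%:R) ^+ d :> R.
Proof.
elim: d n => [|d IH] n /andP[n0 nM].
  rewrite size_hyperbolic_crossS expr0 mulr1 expr1 -natrM ler_nat /=.
  rewrite (eq_bigr (fun=> 1%N))// sum_nat_const_nat; lia.
rewrite size_hyperbolic_crossS.
set S := (\sum_(1 <= k < n.+1) _)%N.
have L0 : 0 <= 1 + ln M%:R :> R.
  by rewrite addr_ge0// ln_ge0// ler1n (leq_trans n0).
have HS : S%:R <= 3 ^+ d.+1 * n%:R * (1 + ln M%:R) ^+ d.+1 :> R.
  rewrite /S natr_sum.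
  apply: (@le_trans _ _ (\sum_(1 <= k < n.+1) (3 ^+ d.+1 * n%:R * (1 + ln M%:R) ^+ d) *
      k%:R^-1)).
    rewrite big_nat [leRHS]big_nat; apply: ler_sum => k /andP[k1 kn].
    have nk : (0 < n %/ k <= M)%N.
      by rewrite divn_gt0// -ltnS kn (leq_trans (leq_div _ _)).
    apply: le_trans (IH _ nk) _.
    rewrite [leRHS]mulrAC ler_wpM2r ?exprn_ge0// -mulrA ler_wpM2l ?exprn_ge0//.
    by rewrite ler_pdivlMr ?ltr0n// -natrM ler_nat leq_trunc_div.
  rewrite -mulr_sumr [X in _ <= _ * X]exprSr mulrA ler_wpM2l//.
    by rewrite !mulr_ge0 ?exprn_ge0.
  apply: le_trans (harmonic_le n0) _; rewrite lerD2l ler_ln ?posrE ?ltr0n ?ler_nat//.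
  exact: leq_trans n0 nM.
(* The slice of first coordinate 0 is the term [k = 1] of [S], so the whole is at most [3 S]. *)
apply: (@le_trans _ _ (S%:R + S.*2%:R)).
  rewrite natrD lerD2r ler_nat /S big_ltn// divn1; lia.
rewrite -natrD -muln2 -mulnS natrM.
apply: (le_trans (ler_wpM2r _ HS)) => //.
by rewrite [in leRHS]exprS mulrC !mulrA.
Qed.

End hyperbolic_cross.

(** * Growth of [P_N] and the choice of [N] and of the number of draws *)

Section parameters.
Context {R : realType} (alpha : R) (gamma : nat -> R) (tau delta : R) (d : nat).
Hypothesis d_gt0 : (0 < d)%N.
Hypothesis alpha_gt0 : 0 < alpha.
Hypothesis gamma_gt0 : forall j, 0 < gamma j.
Hypothesis gamma_le1 : forall j, gamma j <= 1.
Hypothesis tau_gt0 : 0 < tau.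
Hypothesis delta01 : 0 < delta < 1.

(** The leading coefficient of [P_N] as a polynomial of degree [d] in [ln N]. *)
Let kappa : R := \prod_(j < d) (2 * gamma j `^ (1 / (2 * alpha)) * tau).

Let kappa_gt0 : 0 < kappa.
Proof. by apply: prodr_gt0 => j _; rewrite !mulr_gt0 ?powR_gt0. Qed.

Lemma P_N_ge N : (0 < N)%N -> kappa * ln N%:R ^+ d <= P_N alpha gamma N tau d.
Proof.
move=> N0; have lnN : 0 <= ln N%:R :> R by rewrite ln_ge0// ler1n.
rewrite -[X in _ ^+ X]card_ord -prodr_const -big_split/=.
apply: ler_prod => j _; rewrite !mulr_ge0 ?powR_ge0 ?(ltW tau_gt0)//=.
have := @powR_gt0 _ (gamma j) (1 / (2 * alpha)) (gamma_gt0 j).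
set g := _ `^ _ => g0.
have := mulr_ge0 (mulr_ge0 (ltW g0) (ltW tau_gt0)) lnN; nra.
Qed.

(** The weights are at most 1, so with [t = ln N >= 1] each factor is at most
    [3 + 2 tau t <= (3 + 2 tau) t]. *)
Lemma P_N_le N : 1 <= ln N%:R :> R ->
  P_N alpha gamma N tau d <= ((3 + 2 * tau) * ln N%:R) ^+ d.
Proof.
move=> lnN; rewrite -[X in _ ^+ X]card_ord -prodr_const.
have t0 := tau_gt0.
apply: ler_prod => j _.
have g0 : 0 <= gamma j `^ (1 / (2 * alpha)) by exact: powR_ge0.
have g1 : gamma j `^ (1 / (2 * alpha)) <= 1.
  rewrite -[leRHS](powRr0 (gamma j)); apply: ger_powR.
    by rewrite gamma_gt0 gamma_le1.
  by rewrite divr_ge0// mulr_ge0// ltW.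
move: g0 g1; set g := _ `^ _; set t := ln _ in lnN * => g0 g1.
have tt : 0 <= tau * t by rewrite mulr_ge0// ?ltW// (lt_le_trans ltr01).
apply/andP; split; first by rewrite addr_ge0// !mulr_ge0// addr_ge0.
apply: (@le_trans _ _ (1 + 2 * 1 * (1 + tau * t))); last by nra.
by rewrite lerD2l ler_wpM2r ?addr_ge0// ler_wpM2l.
Qed.

(** Everything is expressed in [t = ln N], taken above finitely many thresholds. Here [eps] controls
    the size of the frequency set and [lam] becomes a lower bound for [ln (N - 1)]. *)
Lemma parameter_choice (eps lam : R) : 0 < eps -> 0 < lam -> exists N k : nat,
  [/\ prime N, 1 <= N_star alpha gamma N tau d, 2 * N_star alpha gamma N tau d < N%:R
    & 3 ^+ d * N_star alpha gamma N tau d * (1 + ln N%:R) ^+ d.-1 <= eps * (N%:R - 1)] /\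
  [/\ lam <= ln (N%:R - 1), (0 < k)%N, expR (- (2 * k%:R)) * N%:R <= delta
    & (k.*2.-1)%:R <= 2 * ln (1 + (N%:R - 1) / (4 * expR 1)) + 2 * ln delta^-1 + 1].
Proof.
move=> eps0 lam0; have [delta0 delta1] := andP delta01.
have ld0 : 0 <= ln delta^-1 by rewrite ln_ge0// invf_ge1// ltW.
(* Thresholds for [t]: [C1] gives [N_* >= 1]; [C2] gives [P_N >= 2], hence [2 N_* < N]; [C3] gives
   the bound with [eps], one power of [t] being the gain of [P_N] over the hyperbolic cross. *)
pose C1 := 2 * d.+1`!%:R * expR tau^-1 * (3 + 2 * tau) ^+ d.
pose C2 := 2 / kappa.
pose C3 := 3 ^+ d * 2 ^+ d.-1 / (kappa * eps).
have C1_ge0 : 0 <= C1.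
  by rewrite !mulr_ge0 ?expR_ge0 ?exprn_ge0 ?addr_ge0 ?mulr_ge0// ltW.
have C2_ge0 : 0 <= C2 by rewrite divr_ge0// ltW.
have C3_ge0 : 0 <= C3.
  by rewrite divr_ge0 ?mulr_ge0 ?exprn_ge0// ltW.
(* The summand [lam] serves [lam <= ln (N - 1)], and 8 serves the bound on [2k - 1], where
   [2 ln (4e) <= 8] must be absorbed by [t]. *)
pose T0 := 8 + C1 + C2 + C3 + lam.
have [N Nlarge pN] := prime_above (Num.truncn (expR T0)).
pose t := ln N%:R : R.
have N1 : (1 < N)%N by exact: prime_gt1.
have N0 : (0 < N)%N by exact: ltnW.
have N0R : 0 < N%:R :> R by rewrite ltr0n.
have tE : expR t = N%:R by rewrite /t lnK ?posrE.
have tT0 : T0 <= t.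
  rewrite -ler_expR tE ltW//; apply: lt_le_trans (truncnS_gt _) _.
  by rewrite ler_nat.
have t6 : 8 <= t by move: tT0; rewrite /T0; lra.
have t1 : 1 <= t by move: t6; lra.
have tC1 : C1 <= t by move: tT0; rewrite /T0; lra.
have tC2 : C2 <= t by move: tT0; rewrite /T0; lra.
have tC3 : C3 <= t by move: tT0; rewrite /T0; lra.
have tlam : lam + 1 <= t by move: tT0; rewrite /T0; lra.
have N2R : 2 <= N%:R :> R by rewrite ler_nat.
have P0 : 0 < P_N alpha gamma N tau d.
  apply: lt_le_trans (P_N_ge N0); rewrite mulr_gt0// exprn_gt0//.
  by apply: lt_le_trans t1.
have Pge := P_N_ge N0; have Ple := P_N_le t1.
rewrite -/t in Pge Ple.
set P := P_N _ _ _ _ _ in P0 Pge Ple; pose e1 := expR tau^-1.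
have e1_ge1 : 1 <= e1 by rewrite -(expR0 R) ler_expR invr_ge0 ltW.
have e1_gt0 : 0 < e1 by exact: lt_le_trans e1_ge1.
have eP0 : 0 < e1 * P by exact: mulr_gt0.
have PeP : P <= e1 * P by rewrite ler_peMl// ltW.
have t0 : 0 < t by exact: lt_le_trans t1.
have dE : d = d.-1.+1 by rewrite prednK.
have N1R : 0 < N%:R - 1 :> R by rewrite subr_gt0 ltr1n.
have P2 : 2 <= e1 * P.
  apply: le_trans PeP; apply: le_trans Pge.
  apply: (@le_trans _ _ (kappa * t)).
    by rewrite mulrC -ler_pdivrMr.
  by rewrite ler_pM2l// -[leLHS]expr1 ler_weXn2l.
(* [k] exceeds [(t + ln (1 / delta)) / 2], so that [N] times [e^(- 2 k)] is at most [delta], while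
   [k - 1] does not exceed it. *)
exists N, (Num.truncn ((t + ln delta^-1) / 2)).+1; rewrite /N_star -/P -/e1; split; split
    => //.
- rewrite ler_pdivlMr// mul1r.
  (* [e^t] beats the bound of degree [d] on [P_N]. *)
  apply: (@le_trans _ _ (t ^+ d.+1 / d.+1`!%:R)); last first.
    by rewrite lerBrDl -tE expR_ge1Dxn// ltW.
  rewrite ler_pdivlMr ?ltr0n ?fact_gt0//.
  apply: (@le_trans _ _ (C1 * t ^+ d)); last by rewrite exprS ler_wpM2r// exprn_ge0// ltW.
  apply: (@le_trans _ _ (e1 * ((3 + 2 * tau) * t) ^+ d * d.+1`!%:R)).
    by rewrite ler_wpM2r// ler_wpM2l// ltW.
  rewrite /C1 -/e1 exprMn.
  set a := (3 + 2 * tau) ^+ d; set b := t ^+ d; set f := _%:R.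
  have : 0 <= e1 * (a * b) * f.
    have a0 : 0 <= a by rewrite exprn_ge0// addr_ge0// mulr_ge0// ltW.
    have b0 : 0 <= b by rewrite exprn_ge0// ltW.
    by rewrite mulr_ge0// mulr_ge0 ?mulr_ge0// ltW.
  rewrite (_ : 2 * f * e1 * a * b = 2 * (e1 * (a * b) * f)); last by ring.
  by move=> H; rewrite ler_peMl// ler1n.
- have : (N%:R - 1) / (e1 * P) <= (N%:R - 1) / 2.
    by rewrite ler_pM2l// lef_pV2 ?posrE.
  lra.
- set Ns1 := N%:R - 1 in N1R *.
  rewrite -/t mulrAC mulrA ler_pdivrMr// [leRHS]mulrAC; apply: ler_wpM2r; first exact: ltW.
  apply: (@le_trans _ _ (eps * P)); last by rewrite ler_pM2l.
  apply: (@le_trans _ _ (eps * (kappa * t ^+ d))); last by rewrite ler_pM2l.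
  rewrite [in leRHS]dE exprS.
  have h2 : (1 + t) ^+ d.-1 <= 2 ^+ d.-1 * t ^+ d.-1.
    by rewrite -exprMn lerXn2r ?nnegrE; [|lra..].
  have h3 : 3 ^+ d * 2 ^+ d.-1 <= t * (kappa * eps).
    by rewrite -ler_pdivrMr// mulr_gt0.
  apply: (@le_trans _ _ (3 ^+ d * (2 ^+ d.-1 * t ^+ d.-1))).
    by rewrite ler_wpM2l// exprn_ge0.
  rewrite mulrA; apply: (le_trans (ler_wpM2r _ h3)); first by rewrite exprn_ge0// ltW.
  by rewrite le_eqVlt; apply/orP; left; apply/eqP; ring.
- have h : N%:R / 2 <= N%:R - 1 :> R by lra.
  apply: (@le_trans _ _ (ln (N%:R / 2))); last by rewrite ler_ln ?posrE ?divr_gt0.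
  rewrite ln_div ?posrE// -/t.
  have : ln 2 <= 1 :> R by rewrite (_ : 2 = 1 + 1)// le_ln1Dx.
  lra.
- have h : (t + ln delta^-1) / 2 <= (Num.truncn ((t + ln delta^-1) / 2)).+1%:R by rewrite
    ltW// truncnS_gt.
  apply: (@le_trans _ _ (expR (- (t + ln delta^-1)) * N%:R)).
    rewrite ler_wpM2r// ler_expR; move: h; set q := _.+1%:R => h.
    by rewrite lerN2 mulrC -ler_pdivrMr.
  rewrite opprD expRD expRN tE mulrAC mulVf ?gt_eqF// mul1r.
  by rewrite lnV ?posrE// opprK lnK ?posrE.
- rewrite doubleS /= -addn1 natrD -muln2 natrM.
  have h : (Num.truncn ((t + ln delta^-1) / 2))%:R <= (t + ln delta^-1) / 2.
    by rewrite truncn_le divr_ge0// addr_ge0// ltW.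
  (* Since [2k - 1 = 2 (k - 1) + 1], it is at most [t + ln (1 / delta) + 1]. *)
  suff : t <= 2 * ln (1 + (N%:R - 1) / (4 * expR 1)) + ln delta^-1 by lra.
  have e0 : 0 < 4 * expR 1 :> R by rewrite mulr_gt0// expR_gt0.
  apply: (@le_trans _ _ (2 * ln (N%:R / (4 * expR 1)))).
    rewrite ln_div ?posrE// lnM ?posrE ?expR_gt0// expRK -/t.
    have : ln 4 <= 3 :> R.
      have -> : 4 = 1 + 3 :> R by ring.
      by apply: le_ln1Dx; lra.
    by move: t6; lra.
  apply: (@le_trans _ _ (2 * ln (1 + (N%:R - 1) / (4 * expR 1)))); last by lra.
  rewrite ler_pM2l// ler_ln ?posrE ?divr_gt0//; last by rewrite addr_gt0// divr_gt0.
  rewrite mulrBl addrCA lerDl subr_ge0.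
  by rewrite mul1r invf_le1//; have := expR_ge1Dx (1 : R); lra.
Qed.

End parameters.

(** * Error of the median algorithm *)

Section frequency_set.
Context {R : realType} {d : nat} (alpha : R) (gamma : nat -> R).
Hypothesis alpha_gt0 : 0 < alpha.
Hypothesis gamma_gt0 : forall j, 0 < gamma j.
Hypothesis gamma_le1 : forall j, gamma j <= 1.
Implicit Types h l : d.-tuple int.

Let a2_gt0 : 0 < 2 * alpha. Proof. by rewrite mulr_gt0. Qed.

(** Weights at most 1 only enlarge the factors. This places the frequency set inside a hyperbolic
    cross that does not depend on the weights. *)
Lemma korobov_r_ge h :
  (\prod_(j < d) freq_size (tnth h j))%:R `^ (2 * alpha) <= korobov_r alpha gamma h.
Proof.
rewrite (big_morph (fun n : nat => n%:R `^ (2 * alpha) : R) (id1 := 1) (op1 := *%R));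
    last 2 first.
- by move=> m n; rewrite natrM powRM.
- by rewrite powR1.
apply: ler_prod => j _; rewrite powR_ge0/=.
rewrite /freq_size le_max; have [->|a0] := eqVneq (tnth h j) 0.
  by rewrite /= powR1 lexx orbT.
rewrite (_ : (maxn _ _)%:R = `|(tnth h j)%:~R|); last first.
  rewrite -intr_norm (maxn_idPl _) ?absz_gt0//.
by apply/orP; left; rewrite ler_pdivlMr// ler_piMr// powR_ge0.
Qed.

Lemma korobov_r_ge1 h : 1 <= korobov_r alpha gamma h.
Proof.
rewrite /korobov_r; elim/big_ind : _ => // [x y|j _]; first exact: mulr_ege1.
by rewrite le_max lexx orbT.
Qed.

Lemma freq_set_prod_le (L : R) h : 0 <= L -> freq_set alpha gamma L h ->
  (\prod_(j < d) freq_size (tnth h j) <= Num.truncn L)%N.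
Proof.
move=> L0 hL; rewrite truncn_ge_nat// leNgt; apply/negP => lt.
have : L `^ (2 * alpha) < (\prod_(j < d) freq_size (tnth h j))%:R `^ (2 * alpha).
  by apply: gt0_ltr_powR => //; rewrite nnegrE.
by rewrite ltNge (le_trans (korobov_r_ge h)).
Qed.

Lemma freq_set_coord_le (L : R) h j : 0 <= L -> freq_set alpha gamma L h ->
  (`|tnth h j| <= Num.truncn L)%N.
Proof.
move=> L0 /(freq_set_prod_le L0); apply: leq_trans.
rewrite (bigD1 j)//=; apply: (@leq_trans (freq_size (tnth h j))).
  by rewrite /freq_size; lia.
by rewrite leq_pmulr// prodn_gt0// => i; exact: freq_size_gt0.
Qed.

Lemma freq_set_hyperbolic (L : R) : 0 <= L ->
  freq_set alpha gamma L `<=` [set h | h \in hyperbolic_cross d (Num.truncn L)].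
Proof. by move=> L0 h hL; apply: mem_hyperbolic_cross; exact: freq_set_prod_le. Qed.

Lemma finite_freq_set (L : R) : 0 <= L -> finite_set (@freq_set R d alpha gamma L).
Proof.
by move=> L0; apply: sub_finite_set (freq_set_hyperbolic L0) _; exact: finite_seq.
Qed.

Lemma card_freq_set (L : R) : 0 <= L ->
  (#|` fset_set (@freq_set R d alpha gamma L)| <= size (hyperbolic_cross d (Num.truncn
      L)))%N.
Proof.
move=> L0; apply: uniq_leq_size => // h.
by rewrite in_fset_set ?inE; [exact: freq_set_hyperbolic|exact: finite_freq_set].
Qed.

(** Coordinates are at most [L] in absolute value, so their differences stay below [N], and only the
    difference 0 is divisible by [N]. *)
Lemma freq_set_incongruent (N : nat) (L : R) h l : 0 <= L -> 2 * L < N%:R ->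
  freq_set alpha gamma L h -> freq_set alpha gamma L l -> l != h -> ~~ congruent N h l.
Proof.
move=> L0 LN hL lL; apply: contra => /forallP H; apply/eqP/eq_from_tnth => j.
have hj := freq_set_coord_le j L0 hL; have lj := freq_set_coord_le j L0 lL.
have tN : ((Num.truncn L).*2 < N)%N.
  rewrite -(ltr_nat R); apply: le_lt_trans LN.
  by rewrite -muln2 natrM mulrC ler_pM2l// truncn_le.
have := H j; rewrite dvdzE => D; apply/eqP; apply: contraT => ne.
have pos : (0 < `|tnth l j - tnth h j|)%N by rewrite absz_gt0 subr_eq0.
have := dvdn_leq pos D; rewrite leqNgt; apply: contraNT => _ /=.
by move: hj lj tN; generalize (tnth h j) (tnth l j) (Num.truncn L) => a b n; lia.
Qed.

End frequency_set.

(** * The [L_2] error of an approximation with finitely many frequencies *)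

Section error_norm.
Context {R : realType} {d : nat}.
Local Notation mR := (measurableTypeR R).
Local Notation I := (d.-tuple int).

Lemma sqr_L2norm (u : d.-tuple R -> R[i]) :
  (L2norm u ^+ 2 = \int[cube_measure R d]_x (cmod (u x) ^+ 2)%:E)%E.
Proof.
rewrite /L2norm unlock /=.
have -> : (\int[cube_measure R d]_x (`|cmod (u x)| `^ 2)%:E =
    \int[cube_measure R d]_x (cmod (u x) ^+ 2)%:E)%E.
  by apply: eq_integral => x _; rewrite ger0_norm ?cmod_ge0// powR_mulrn ?cmod_ge0.
have : (0 <= \int[cube_measure R d]_x (cmod (u x) ^+ 2)%:E)%E.
  by apply: integral_ge0 => x _; rewrite lee_fin sqr_ge0.
case: (integral _ _ _) => [r|_|//].
  by rewrite lee_fin => r0; rewrite /= powR12_sqrt// -EFinM -expr2 sqr_sqrtr.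
by rewrite poweRyr ?invr_eq0// mulyy.
Qed.

Variables (c : I -> R[i]) (f : d.-tuple R -> R[i]).
Hypothesis cfin : (\esum_(h in [set: I]) (cmod (c h))%:E < +oo)%E.
Hypothesis cf : forall x, has_csum (fun h => c h * cexp2pi (dotp h x)) (f x).

Lemma sqr_L2norm_approx (A : {fset I}) (W : I -> R[i]) :
  (L2norm (fun x => (f x - \sum_(h <- A) W h * cexp2pi (dotp h x))%R) ^+ 2 =
   (\sum_(h <- A) cmod (W h - c h) ^+ 2)%:E +
   \esum_(h in [set: I]) (if h \in A then 0 else cmod (c h) ^+ 2)%:E)%E.
Proof.
rewrite sqr_L2norm.
(* With [W] extended by 0 outside [A], the error has Fourier coefficients [c h - V h], and Parseval
   splits into the two sums. *)
pose V h := if h \in A then W h else 0.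
have sumA (g : I -> R) : (forall h, 0 <= g h) ->
    (\esum_(h in [set: I]) (if h \in A then g h else 0)%:E = (\sum_(h <- A) g h)%:E)%E.
  move=> g0; rewrite -sumEFin fsbig_seq// -esum_fset//; last by move=> h _; rewrite lee_fin.
  rewrite [RHS]esum_mkcond; apply: eq_esum => h _.
  rewrite (_ : (h \in [set` A]) = (h \in A)); first by case: ifP.
  by apply/idP/idP; rewrite inE.
rewrite (@parseval R d (fun h => c h - V h)).
- rewrite -sumA => [|h]; last exact: sqr_ge0.
  rewrite -esumD => [|h _|h _]; [|by rewrite lee_fin; case: ifP => // _; exact: sqr_ge0..].
  apply: eq_esum => h _; rewrite -EFinD /V; case: ifP => _; last by rewrite subr0 add0r.
  by rewrite addr0 -opprB complex.normcN.
- apply: (@le_lt_trans _ _ (\esum_(h in [set: I]) ((cmod (c h))%:E +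
      (if h \in A then cmod (W h) else 0)%:E))%E).
    apply: le_esum => h _; rewrite -EFinD lee_fin; apply: le_trans (cmodD _ _) _.
    rewrite complex.normcN lerD2l /V; case: ifP => //.
    by rewrite cmod0.
  rewrite esumD => [|h _|h _]; rewrite ?lee_fin ?cmod_ge0//; last by case: ifP => // _;
      exact: cmod_ge0.
  rewrite sumA => [|h]; last exact: cmod_ge0.
  by rewrite lte_add_pinfty// ltry.
- move=> x.
  pose v h := - (V h * cexp2pi (dotp h x)).
  have v0 h : h \notin A -> v h = 0 by rewrite /v /V => /negbTE ->; rewrite mul0r oppr0.
  have := has_csum_add (cf x) (has_csum_fin v0).
  have -> : \sum_(h <- A) v h = - \sum_(h <- A) W h * cexp2pi (dotp h x).
    rewrite -sumrN; apply: eq_big_seq => h hA; by rewrite /v /V hA.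
  by apply: eq_has_csum => h; rewrite mulrBl.
Qed.

End error_norm.

(** Open upper rays generate the Borel sets, and the event that the median exceeds [y] is the
    complement of a counting event. *)
Lemma measurable_median {R : realType} dT (T : measurableType dT) m (g : T -> R) :
  (0 < m)%N -> measurable_fun setT g ->
  measurable_fun setT (fun w : m.-tuple T => median [seq g x | x <- w]).
Proof.
move=> m0 mg.
apply: (measurability (@RGenOInfty.G R)) => [|/= _ [_ [y ->] <-]].
  exact: RGenOInfty.measurableE.
apply: measurableI => //.
rewrite (_ : _ @^-1` _ = ~` [set w : m.-tuple T | (m./2 < count (fun x => g x <= y)%R
    w)%N]).
  apply: measurableC; apply: (@measurable_count _ _ R).
  rewrite (_ : [set x | _] = setT `&` [set x | ((g x)%:E <= y%:E)%E]).
    by apply: emeasurable_fun_infty_c => //; exact/measurable_EFinP.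
  by rewrite setTI; apply/seteqP; split => x /=; rewrite lee_fin.
apply/seteqP; split => w /=; rewrite in_itv/= andbT ltNge median_le ?size_map ?size_tuple
    ?count_map //.
- by move/negP.
- by rewrite -size_eq0 size_map size_tuple -lt0n.
- by move/negP.
- by rewrite -size_eq0 size_map size_tuple -lt0n.
Qed.

(** * Error of the median estimator and its failure probability *)

Section median_estimate.
Context {R : realType} {d : nat} (N : nat) (pN : prime N).
Local Notation mR := (measurableTypeR R).
Local Notation I := (d.-tuple int).
Local Notation sample := (d.-tuple nat * d.-tuple mR)%type.
Variables (c : I -> R[i]) (f : d.-tuple R -> R[i]).
Hypothesis cfin : (\esum_(h in [set: I]) (cmod (c h))%:E < +oo)%E.
Hypothesis cf : forall x, has_csum (fun h => c h * cexp2pi (dotp h x)) (f x).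
Variables (A : {fset I}) (T lam : R).
Hypothesis A_incongruent : forall h l, h \in A -> l \in A -> l != h -> ~~ congruent N h l.
Hypothesis A_card : #|` A|%:R <= N%:R - 1 :> R.
Hypothesis TE : (\esum_(l in [set: I]) (if l \in A then 0 else cmod (c l) ^+ 2)%:E =
    T%:E)%E.
Hypothesis lam_gt0 : 0 < lam.

Let N1 : (1 < N)%N. Proof. exact: prime_gt1. Qed.
Let N1R : 0 < N%:R - 1 :> R. Proof. by rewrite subr_gt0 ltr1n. Qed.

Lemma alias_weight_le1 (h l : I) : alias_weight N h l <= 1 :> R.
Proof.
rewrite /alias_weight; case: ifP => // _; rewrite invf_le1//.
by have : 2 <= N%:R :> R by [rewrite ler_nat]; lra.
Qed.

Let term (h l : I) : \bar R := (if l \in A then 0 else cmod (c l) ^+ 2 * alias_weight N h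
    l)%:E.

Let term_ge0 h l : (0 <= term h l)%E.
Proof.
by rewrite lee_fin; case: ifP => // _; rewrite mulr_ge0 ?sqr_ge0// alias_weight_ge0.
Qed.

(** The level that serves as [V] in [bad_sample]. Nothing is lost by [fine]: alias weights are at
    most 1, so the sum is at most [T]. *)
Definition alias_tail (h : I) : R := fine (\esum_(l in [set: I]) term h l)%E.

Lemma alias_tailE h : (\esum_(l in [set: I]) term h l = (alias_tail h)%:E)%E.
Proof.
rewrite /alias_tail fineK// ge0_fin_numE ?esum_ge0//.
apply: (@le_lt_trans _ _ T%:E); last exact: ltry.
rewrite -TE; apply: le_esum => l _; rewrite lee_fin; case: ifP => // _.
by rewrite ler_piMr ?sqr_ge0// alias_weight_le1.
Qed.

Lemma alias_tail_ge0 h : 0 <= alias_tail h.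
Proof. by rewrite fine_ge0// esum_ge0. Qed.

Lemma sum_alias_weight_le l : \sum_(h <- A) alias_weight N h l <= 2 :> R.
Proof.
apply: (@le_trans _ _ (\sum_(h <- A) ((congruent N h l)%:R + (N%:R - 1)^-1))).
  apply: ler_sum => h _; rewrite /alias_weight; case: ifP => _; last by rewrite add0r.
  by rewrite lerDl invr_ge0 ltW.
rewrite big_split/= -natr_sum [leRHS](_ : _ = 1 + 1)//; apply: lerD.
  rewrite (_ : \sum_(h <- A) _ = count (fun h => congruent N h l) A)%N; last first.
    by rewrite -sum1_count [RHS]big_mkcond.
  have [/hasP[h0 h0A h0l]|noh] := boolP (has (fun h => congruent N h l) A); last first.
    by move: noh; rewrite has_count -eqn0Ngt => /eqP ->; rewrite ler01.
  rewrite lern1.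
  apply: (@leq_trans (count_mem h0 A)); last by rewrite count_uniq_mem ?fset_uniq ?leq_b1.
  have -> : count (fun h => congruent N h l) A = count (fun h => congruent N h l && (h ==
      h0)) A.
    apply: eq_in_count => h hA; case: (boolP (congruent N h l)) => //= hl; apply/esym.
    apply: contraT => hh0; have := A_incongruent h0A hA hh0.
    case/negP; apply/forallP => j.
    move/forallP: hl => /(_ j) hl; move/forallP: h0l => /(_ j) h0l.
    rewrite (_ : tnth h j - tnth h0 j = (tnth l j - tnth h0 j) - (tnth l j - tnth h j)).
      exact: rpredB.
    by ring.
  by apply: sub_count => h /andP[].
rewrite big_const_seq count_predT iter_addr_0.
by rewrite -[leLHS]mulr_natl ler_pdivrMr// mul1r.
Qed.

Lemma sum_alias_tail_le : \sum_(h <- A) alias_tail h <= 2 * T.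
Proof.
rewrite -lee_fin -sumEFin.
under eq_bigr do rewrite -alias_tailE.
rewrite -esum_sum//.
(* After exchanging the sums, the total weight 2 of each [l] outside [A] is written as two copies of
   the tail, each equal to [T]. *)
apply: (@le_trans _ _ (\esum_(l in [set: I]) ((if l \in A then 0 else cmod (c l) ^+ 2)%:E +
   (if l \in A then 0 else cmod (c l) ^+ 2)%:E))%E).
  apply: le_esum => l _; rewrite /term sumEFin -EFinD lee_fin.
  case: ifP => _; first by rewrite big1_eq addr0.
  rewrite -mulr_sumr -mulr2n -[leRHS]mulr_natr ler_wpM2l ?sqr_ge0//.
  exact: sum_alias_weight_le.
rewrite esumD => [|l _|l _]; [|by rewrite lee_fin; case: ifP => // _; exact: sqr_ge0..].
by rewrite !TE -EFinD mulr_natl mulr2n.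
Qed.

Lemma cmeasurable_median_coef m h : (0 < m)%N ->
  cmeasurable (fun w : m.-tuple sample => median_coef f N w h).
Proof.
move=> m0; have [mRe mIm] := measurable_lattice_coef N h cf.
split; rewrite /median_coef /cmedian /=.
  under [X in measurable_fun _ X]funext do rewrite -map_comp.
  exact: measurable_median.
under [X in measurable_fun _ X]funext do rewrite -map_comp.
exact: measurable_median.
Qed.

Definition median_error m (w : m.-tuple sample) : R :=
  \sum_(h <- A) cmod (median_coef f N w h - c h) ^+ 2.

Lemma measurable_median_error m : (0 < m)%N -> measurable_fun setT (@median_error m).
Proof.
move=> m0; apply: measurable_sum => h; apply: cmeasurable_sqr_cmod.
have [mRe mIm] := cmeasurable_median_coef h m0; split.
  rewrite [X in measurable_fun _ X](_ : _ = fun w : m.-tuple sample =>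
    complex.Re (median_coef f N w h) - complex.Re (c h)).
    exact: measurable_funB.
  by apply/funext => p; rewrite raddfB.
rewrite [X in measurable_fun _ X](_ : _ = fun w : m.-tuple sample =>
    complex.Im (median_coef f N w h) - complex.Im (c h)).
  exact: measurable_funB.
by apply/funext => p; rewrite raddfB.
Qed.

Lemma sqr_L2norm_median m (w : m.-tuple sample) :
  (L2norm (fun x => (f x - \sum_(h <- A) median_coef f N w h * cexp2pi (dotp h x))%R) ^+ 2 =
   (median_error w + T)%:E)%E.
Proof. by rewrite (sqr_L2norm_approx cfin cf) TE. Qed.

Let bad h : sample -> bool := bad_sample N c f A h (alias_tail h) lam.

(** Real and imaginary parts have separate medians. Each is off by at most the square root [t] of
    [lam * alias_tail h], a draw with a larger deviation in either part being bad; the two squares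
    account for the factor 2. *)
Lemma median_coef_le m (w : m.-tuple sample) h : odd m ->
  (count (bad h) w <= m./2)%N ->
  cmod (median_coef f N w h - c h) ^+ 2 <= 2 * (lam * alias_tail h).
Proof.
move=> om hw.
have lV0 : 0 <= lam * alias_tail h by rewrite mulr_ge0 ?alias_tail_ge0// ltW.
pose t := Num.sqrt (lam * alias_tail h).
have H (g : R[i] -> R) : (forall z1 z2, g (z1 - z2) = g z1 - g z2) -> (forall z, `|g z|
    <= cmod z) ->
    `|median [seq g z | z <- [seq lattice_coef f N p.1 p.2 h | p <- w]] - g (c h)| <= t.
  move=> gB gle; apply: median_dist; rewrite ?size_map ?size_tuple//.
  apply: leq_trans hw; rewrite -map_comp count_map; apply: sub_count => p /=.
  rewrite -ltNge => lt; apply/orP; right.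
  have : t < cmod (lattice_coef f N p.1 p.2 h - c h) by apply: lt_le_trans lt _; rewrite
      -gB.
  by rewrite -ltr_sqr ?nnegrE ?sqrtr_ge0 ?cmod_ge0// sqr_sqrtr.
rewrite sqr_cmod !raddfB/= mulr_natl mulr2n -(sqr_sqrtr lV0) -/t.
have tsq (y : R) : `|y| <= t -> y ^+ 2 <= t ^+ 2.
  by move=> yt; rewrite -[y ^+ 2]real_normK ?num_real// lerXn2r ?nnegrE ?sqrtr_ge0.
apply: lerD; apply: tsq.
  by apply: (H (@complex.Re R)); [exact: raddfB|exact: ler_Re_cmod].
by apply: (H (@complex.Im R)); [exact: raddfB|exact: ler_Im_cmod].
Qed.

Lemma median_error_le m (w : m.-tuple sample) : odd m ->
  (forall h, h \in A -> (count (bad h) w <= m./2)%N) -> median_error w <= 4 * lam * T.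
Proof.
move=> om hw.
apply: (@le_trans _ _ (\sum_(h <- A) 2 * (lam * alias_tail h))).
  by rewrite /median_error big_seq [leRHS]big_seq; apply: ler_sum => h hA; apply:
      median_coef_le => //; exact: hw.
rewrite -!mulr_sumr.
have := ler_wpM2l (ltW lam_gt0) sum_alias_tail_le; lra.
Qed.

Let p : R := #|` A|%:R / (N%:R - 1) + lam^-1.

(** A failure forces, for some [h] in [A], at least [m./2.+1] bad draws out of [m]. The binomial
    tail bound applies to each [h], and a union bound over [A] finishes. *)
Lemma median_algorithm_estimate m (B : R) : odd m -> (1 + 4 * lam) * T <= B ->
  let good : set (m.-tuple sample) := [set w |
    (L2norm (fun x => (f x - \sum_(h <- A) median_coef f N w h * cexp2pi (dotp h x))%R) ^+ 2
       <= B%:E)%E] in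
  measurable good /\
  ((1 - #|` A|%:R * ('C(m, m./2.+1)%:R * p ^+ m./2.+1))%:E <= prob_pow (sample_law R N d)
      m good)%E.
Proof.
move=> om TB good.
have m0 : (0 < m)%N by case: m om good.
have goodE : good = [set w | median_error w + T <= B].
  by apply/funext => w; rewrite /good /mkset sqr_L2norm_median lee_fin.
have mgood : measurable good.
  rewrite goodE (_ : [set w | _] = setT `&` [set w : m.-tuple sample | ((median_error w +
      T)%:E <= B%:E)%E]).
    apply: emeasurable_fun_infty_c => //; apply/measurable_EFinP.
    by apply: measurable_funD => //; exact: measurable_median_error.
  by rewrite setTI; apply/seteqP; split => w /=; rewrite lee_fin.
split => //.
(* Membership in [A] is built into the event so that [F h] is measurable for every [h]; the bounds
   on bad draws are available for [h] in [A]. *)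
pose F h : set (m.-tuple sample) := [set w | h \in A /\ (m./2.+1 <= count (bad h) w)%N].
have badP h : h \in A -> measurable [set x : sample | bad h x] /\
    (sample_law R N d [set x | bad h x] <= p%:E)%E.
  move=> hA; apply: bad_sample_le => //.
  - by move=> l lA lh; exact: A_incongruent.
  - exact: alias_tail_ge0.
  - by rewrite -alias_tailE; apply: le_esum => l _.
have mF h : measurable (F h).
  have [hA|hA] := boolP (h \in A); last first.
    by rewrite (_ : F h = set0)//; apply/seteqP; split => // w [] /=; rewrite (negbTE hA).
  rewrite (_ : F h = [set w : m.-tuple sample | (m./2.+1 <= count (bad h) w)%N]).
    by apply: (@measurable_count _ _ R); exact: (badP _ hA).1.
  by apply/seteqP; split => [w []//|w /= ?]; split.
have [mU HU] := @measure_mem_seq_le _ _ _ (prob_pow (sample_law R N d) m) _ A F mF.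
set U := [set w | _] in mU HU.
have UG : ~` good `<=` U.
  move=> w ngw; apply: contrapT => nUw; apply: ngw.
  rewrite goodE /=; apply: le_trans TB; rewrite mulrDl mul1r addrC lerD2l.
  apply: median_error_le => // h hA; rewrite leqNgt; apply/negP => lt.
  by apply: nUw; exists h.
have p0 : 0 <= p by rewrite /p addr_ge0 ?divr_ge0 ?invr_ge0// ltW.
have PU : (prob_pow (sample_law R N d) m U <= (#|` A|%:R * ('C(m, m./2.+1)%:R * p ^+
    m./2.+1))%:E)%E.
  apply: le_trans HU _.
  apply: (@le_trans _ _ (\sum_(h <- A) ('C(m, m./2.+1)%:R * p ^+ m./2.+1)%:E)%E).
    rewrite big_seq [leRHS]big_seq; apply: lee_sum => h hA.
    rewrite (_ : F h = [set w : m.-tuple sample | (m./2.+1 <= count (bad h) w)%N]).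
      by apply: prob_pow_count_le; [exact: (badP _ hA).1|exact: (badP _ hA).2].
    by apply/seteqP; split => [w []//|w /= ?]; split.
  by rewrite sumEFin lee_fin big_const_seq count_predT iter_addr_0 [leRHS]mulr_natl.
rewrite -(setCK good) probability_setC; last exact: measurableC.
rewrite EFinB leeB//; apply: le_trans PU; apply: le_measure; rewrite ?inE//.
exact: measurableC.
Qed.

End median_estimate.

Lemma bin_le_exp2 n k : ('C(n, k) <= 2 ^ n)%N.
Proof.
elim: n k => [|n IH] [|k]; rewrite ?bin0 ?bin0n ?expn_gt0//.
by rewrite binS expnS mul2n -addnn leq_add.
Qed.

Lemma expR_powR {R : realType} (x s : R) : expR x `^ s = expR (s * x).
Proof. by rewrite /powR expR_eq0 expRK. Qed.

(** * Korobov norm and the energy outside the retained frequencies *)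

Section korobov_tail.
Context {R : realType} {d : nat} (alpha : R) (gamma : nat -> R) (f : d.-tuple R -> R[i]).
Local Notation I := (d.-tuple int).
Hypothesis fin : (korobov_sqnorm alpha gamma f < +oo)%E.

Lemma korobov_r_ge0 (h : I) : 0 <= korobov_r alpha gamma h.
Proof. by apply: le_trans (korobov_r_ge1 _ _ h). Qed.

Lemma sqr_korobov_norm : (korobov_norm alpha gamma f ^+ 2)%:E = korobov_sqnorm alpha
    gamma f.
Proof.
have k0 : (0 <= korobov_sqnorm alpha gamma f)%E.
  by apply: esum_ge0 => h _; rewrite lee_fin mulr_ge0 ?sqr_ge0 ?korobov_r_ge0.
rewrite /korobov_norm sqr_sqrtr ?fine_ge0// fineK//.
by rewrite ge0_fin_numE.
Qed.

(** Outside [A] the weight is at least [L], so [L] times any finite part of the tail is at most the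
    squared norm. The tail is finite because all weights are at least 1. *)
Lemma korobov_tail_le (A : {fset I}) (L : R) :
  (forall h, h \notin A -> L <= korobov_r alpha gamma h) -> 0 < L ->
  exists2 T : R,
    (\esum_(l in [set: I]) (if l \in A then 0 else cmod (fourier_coef f l) ^+ 2)%:E =
        T%:E)%E
  & T * L <= korobov_norm alpha gamma f ^+ 2.
Proof.
move=> HA L0.
have g0 l : (0 <= (if l \in A then 0 else cmod (fourier_coef f l) ^+ 2)%:E)%E.
  by rewrite lee_fin; case: ifP => // _; exact: sqr_ge0.
set S := (\esum_(l in _) _)%E.
have Sfin : S \is a fin_num.
  rewrite ge0_fin_numE ?esum_ge0//; apply: le_lt_trans fin.
  apply: le_esum => h _; rewrite lee_fin; case: ifP => _.
    by rewrite mulr_ge0 ?sqr_ge0 ?korobov_r_ge0.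
  by rewrite ler_peMr ?sqr_ge0// korobov_r_ge1.
exists (fine S); first by rewrite fineK.
rewrite -ler_pdivlMr// -lee_fin fineK//.
apply: ge_ereal_sup => _ [X [finX _] <-].
rewrite fsbig_finite// sumEFin lee_fin ler_pdivlMr// mulr_suml -lee_fin sqr_korobov_norm
    -sumEFin.
apply: le_trans (sume_le_esum _ _); last first.
  by move=> h; rewrite lee_fin mulr_ge0 ?sqr_ge0 ?korobov_r_ge0.
apply: lee_sum => h _; rewrite lee_fin; case: ifPn => [_|hA].
  by rewrite mul0r mulr_ge0 ?sqr_ge0 ?korobov_r_ge0.
by rewrite ler_wpM2l ?sqr_ge0// HA.
Qed.

End korobov_tail.

(** * Comparison with the constant [C_N] *)

Section bound_algebra.
Context {R : realType} (alpha : R) (gamma : nat -> R) (tau delta : R) (d N m : nat).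

(** After multiplication by [N_*^(2 alpha)] the right side becomes [Q * nf] times the [2 alpha]-th
    power of [K / m], where [K >= m] and [Q >= 1 + 4 lam]. *)
Lemma bound_ge (nf T lam : R) : 0 < alpha -> 0 < tau -> (1 < N)%N -> (0 < m)%N ->
  0 < P_N alpha gamma N tau d ->
  0 <= nf -> 0 <= lam ->
  m%:R <= 2 * ln (1 + (N%:R - 1) / (4 * expR 1)) + 2 * ln delta^-1 + 1 ->
  2 * lam <= ln (N%:R - 1) ->
  T * N_star alpha gamma N tau d `^ (2 * alpha) <= nf ->
  (1 + 4 * lam) * T <=
    C_N N tau delta alpha * (nf / (m * N)%:R `^ (2 * alpha))
      * expR (2 * alpha * tau^-1) * P_N alpha gamma N tau d `^ (2 * alpha).
Proof.
move=> a0 t0 N1 m0; rewrite /N_star /C_N; set P := P_N _ _ _ _ _; set K := _ + _ + 1.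
set s := 2 * alpha => P0 nf0 lam0 mK lamN; set Ns := (N%:R - 1) / (expR tau^-1 * P) => TN.
have s0 : 0 < s by rewrite mulr_gt0.
have N1R : 0 < N%:R - 1 :> R by rewrite subr_gt0 ltr1n.
have N0R : 0 < N%:R :> R by rewrite ltr0n ltnW.
have m0R : 0 < m%:R :> R by rewrite ltr0n.
have e0 : 0 < expR tau^-1 :> R by exact: expR_gt0.
have K0 : 0 < K by exact: lt_le_trans mK.
have Ns0 : 0 < Ns by rewrite divr_gt0// mulr_gt0.
have Nss0 : 0 < Ns `^ s by exact: powR_gt0.
have ms0 : 0 < m%:R `^ s :> R by exact: powR_gt0.
have Nps0 : 0 < N%:R `^ s :> R by exact: powR_gt0.
rewrite -(ler_pM2r Nss0) -[leLHS]mulrA.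
set Q := 2 * tau^-1 + 1 + _.
(* As [N / (N - 1) >= 1], [Q] is at least [1 + 2 ln (N - 1)], and [2 lam <= ln (N - 1)]. *)
have Qge : 1 + 4 * lam <= Q.
  have l0 : 0 <= ln (N%:R - 1) :> R by apply: le_trans lamN; rewrite mulr_ge0.
  have h : 2 * ln (N%:R - 1) <= 2 * N%:R / (N%:R - 1) * ln (N%:R - 1) :> R.
    rewrite ler_wpM2r// -mulrA ler_peMr// ler_pdivlMr// mul1r lerBlDr lerDl//.
  have : 0 <= 2 * tau^-1 :> R by rewrite mulr_ge0// invr_ge0 ltW.
  by move: h lamN; rewrite /Q; lra.
have key : (N%:R / (N%:R - 1)) `^ s * expR (s * tau^-1) * P `^ s * Ns `^ s = N%:R `^ s.
  rewrite -expR_powR -!powRM ?mulr_ge0 ?divr_ge0 ?invr_ge0 ?(ltW e0) ?(ltW P0) ?(ltW Ns0)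
      ?(ltW N1R) ?(ltW N0R)//;
    last by rewrite mulr_ge0// ltW.
  congr powR; rewrite /Ns; field.
  by rewrite !gt_eqF.
have -> : (N%:R / (N%:R - 1)) `^ s * K `^ s * Q * (nf / (m * N)%:R `^ s) * expR (s / tau)
    * P `^ s * Ns `^ s =
   Q * nf * (K `^ s / m%:R `^ s).
  rewrite natrM powRM// invfM.
  transitivity (K `^ s * Q * nf * (m%:R `^ s)^-1 * (N%:R `^ s)^-1 *
    ((N%:R / (N%:R - 1)) `^ s * expR (s * tau^-1) * P `^ s * Ns `^ s)); first by ring.
  rewrite key; field.
  by rewrite !gt_eqF.
apply: (@le_trans _ _ (Q * nf)).
  apply: (@le_trans _ _ ((1 + 4 * lam) * nf)); last by rewrite ler_wpM2r.
  by rewrite ler_wpM2l// addr_ge0// mulr_ge0.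
rewrite ler_peMr//; first by rewrite mulr_ge0// (le_trans _ Qge)// addr_ge0// mulr_ge0.
rewrite ler_pdivlMr// mul1r; apply: ge0_ler_powR; rewrite ?nnegrE// ltW//.
Qed.

End bound_algebra.

(** * Numerical constants and assembly of the estimates *)

Theorem corollary12 (R : realType) (d : nat) (alpha : R) (gamma : nat -> R)
    (tau delta : R)
    (hd : (1 <= d)%N) (halpha : 1 / 2 < alpha)
    (hgamma_le1 : gamma 0%N <= 1)
    (hgamma_noninc : forall j : nat, gamma j.+1 <= gamma j)
    (hgamma_gt0 : forall j : nat, 0 < gamma j)
    (htau : 0 < tau) (hdelta : 0 < delta < 1) :
  exists N m : nat, [/\ prime N, 1 <= N_star alpha gamma N tau d, odd m &
    forall f : d.-tuple R -> R[i], korobov_space alpha gamma f ->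
    let M : R := (m * N)%:R in
    let error (w : m.-tuple (d.-tuple nat * d.-tuple R)) : \bar R :=
      L2norm (fun x => f x - median_algorithm alpha gamma tau f N w x) in
    let bound : R :=
      C_N N tau delta alpha
      * (korobov_norm alpha gamma f ^+ 2 / M `^ (2 * alpha))
      * expR (2 * alpha * tau^-1)
      * P_N alpha gamma N tau d `^ (2 * alpha) in
    let good : set (m.-tuple (d.-tuple nat * d.-tuple (measurableTypeR R))) :=
      [set w | (error w ^+ 2 <= bound%:E)%E] in
    measurable good /\
    ((1 - delta)%:E <= prob_pow (sample_law R N d) m good)%E].
Proof.
have alpha_gt0 : 0 < alpha by apply: lt_trans halpha; rewrite divr_gt0.
have gamma_le1 j : gamma j <= 1.
  by elim: j => // j; apply: le_trans (hgamma_noninc j).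
(* With these constants a draw is bad with probability at most [p = e^-2 / 4], so that
   [(4 p)^k = e^(- 2 k)]. *)
pose lam : R := 8 * expR 2.
pose eps : R := expR (- 2) / 8.
have e2_gt0 : 0 < expR 2 :> R := expR_gt0 2.
have eN2_gt0 : 0 < expR (- 2) :> R := expR_gt0 (- 2).
have lam_gt0 : 0 < lam by rewrite mulr_gt0.
have eps_gt0 : 0 < eps by rewrite divr_gt0.
have lam2_gt0 : 0 < 2 * lam by rewrite mulr_gt0.
have [N [k [[pN Nstar1 Nstar2 Acard] [Nlam k0 Ndelta kK]]]] :=
  parameter_choice hd alpha_gt0 hgamma_gt0 gamma_le1 htau hdelta eps_gt0 lam2_gt0.
set Ns := N_star alpha gamma N tau d in Nstar1 Nstar2 Acard.
have N1 : (1 < N)%N := prime_gt1 pN.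
have N1R : 0 < N%:R - 1 :> R by rewrite subr_gt0 ltr1n.
have Ns0 : 0 < Ns by exact: lt_le_trans Nstar1.
have P0 : 0 < P_N alpha gamma N tau d.
  have lnN : 0 <= ln N%:R :> R by rewrite ln_ge0// ler1n ltnW.
  apply: prodr_gt0 => j _; rewrite ltr_pwDl// mulr_ge0 ?mulr_ge0 ?powR_ge0//.
  by rewrite addr_ge0// mulr_ge0// ltW.
(* With [m = 2k - 1], the number [m./2.+1] of bad draws needed to spoil the median is exactly
   [k]. *)
have mE : k.*2.-1 = k.-1.*2.+1 by case: k k0 {Ndelta kK}.
have om : odd k.*2.-1 by rewrite mE /= odd_double.
have m0 : (0 < k.*2.-1)%N by rewrite mE.
have mhalf : (k.*2.-1)./2.+1 = k by rewrite mE /= uphalf_double prednK.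
have finA := @finite_freq_set R d alpha gamma alpha_gt0 hgamma_gt0 gamma_le1 Ns (ltW Ns0).
pose A := fset_set (@freq_set R d alpha gamma Ns).
have memA h : (h \in A) = (h \in @freq_set R d alpha gamma Ns) by rewrite in_fset_set.
have cardA : #|` A|%:R <= eps * (N%:R - 1).
  apply: le_trans Acard.
  apply: (@le_trans _ _ (size (hyperbolic_cross d (Num.truncn Ns)))%:R).
    by rewrite ler_nat; apply: card_freq_set => //; exact: ltW.
  rewrite -{1 2}(prednK hd); apply: le_trans (size_hyperbolic_cross _ (M := N) _) _.
    rewrite truncn_gt0 Nstar1 -(ler_nat R) (le_trans (_ : _ <= Ns)) ?truncn_le ?ltW//.
    by move: Nstar2 Ns0; lra.
  rewrite prednK// ler_wpM2r ?exprn_ge0 ?addr_ge0 ?ln_ge0 ?ler1n ?(ltnW N1)//.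
  by rewrite ler_wpM2l ?exprn_ge0// truncn_le ltW.
have eps1 : eps <= 1.
  by rewrite /eps ler_pdivrMr// mul1r; have := @expR_lt1 R (- 2); lra.
have cardA1 : #|` A|%:R <= N%:R - 1 :> R.
  by apply: le_trans cardA _; rewrite ler_piMl// ltW.
exists N, k.*2.-1; split => // f [_ cfin cf sqfin] M error bound good.
have notA h : h \notin A -> Ns `^ (2 * alpha) <= korobov_r alpha gamma h.
  by rewrite memA notin_setE /freq_set /= => /negP; rewrite -ltNge => /ltW.
have [T TE TL] := korobov_tail_le sqfin notA (powR_gt0 _ Ns0).
have TB := @bound_ge R alpha gamma tau delta d N k.*2.-1 (korobov_norm alpha gamma f ^+
    2) T lam
  alpha_gt0 htau N1 m0 P0 (sqr_ge0 _) (ltW lam_gt0) kK Nlam TL.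
have Ainc h l : h \in A -> l \in A -> l != h -> ~~ congruent N h l.
  rewrite !memA !inE => hA lA.
  exact: (freq_set_incongruent alpha_gt0 hgamma_gt0 gamma_le1 (ltW Ns0) Nstar2).
have := @median_algorithm_estimate R d N pN (fourier_coef f) f cfin cf A T lam Ainc
    cardA1 TE lam_gt0
  k.*2.-1 bound om TB.
rewrite mhalf; set good' := [set w | _]; set q := _ + lam^-1.
have -> : good' = good.
  apply/funext => w; rewrite /good' /good /error /mkset; congr (L2norm _ ^+ 2 <= _)%E.
  by apply/funext => x; rewrite /median_algorithm fsbig_finite.
move=> [mgood Hgood]; split => //; apply: le_trans Hgood.
rewrite lee_fin lerD2l lerN2; apply: le_trans Ndelta.
have q0 : 0 <= q by rewrite addr_ge0 ?divr_ge0 ?invr_ge0// ltW.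
(* [eps] and [1 / lam] are both [e^-2 / 8]. *)
have qle : q <= expR (- 2) / 4.
  have -> : expR (- 2) / 4 = eps + lam^-1 :> R.
    by rewrite /eps /lam expRN; field; rewrite gt_eqF.
  by rewrite lerD2r ler_pdivrMr.
have NA : #|` A|%:R <= N%:R :> R by apply: le_trans cardA1 _; rewrite lerBlDr lerDl.
rewrite mulrC ler_pM ?mulr_ge0 ?exprn_ge0//.
(* The factor [4 ^+ k] pays for the binomial coefficient, at most [2 ^ (2k - 1)], and the other
   factor for [q ^+ k]; the union bound over [A] was charged to [N]. *)
have -> : expR (- (2 * k%:R)) = 4 ^+ k * (expR (- 2) / 4) ^+ k :> R.
  by rewrite -exprMn mulrCA divff// mulr1 -expRM_natr mulNr.
apply: ler_pM; rewrite ?exprn_ge0//; last by rewrite lerXn2r ?nnegrE// divr_ge0// ltW.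
apply: (@le_trans _ _ (2 ^ k.*2.-1)%:R); first by rewrite ler_nat bin_le_exp2.
by rewrite -natrX ler_nat (_ : 4 = 2 ^ 2)%N// -expnM mul2n leq_exp2l// leq_pred.
Qed.
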